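(* Let $(R,\mathfrak m)$ be a Noetherian local ring, and let $M$ be a nonzero finitely generated quasi-unmixed $R$-module. Set $\overline R=R/\operatorname{Ann}(M)$ and $c=\max_{P\in\operatorname{Assh}(\overline R)} l_{\overline R_P}(\overline R_P)$. Then $$\frac{n(M)}{\mu(M)}\le c\, n(\overline R),$$ where the right-hand side depends only on $\overline R=R/\operatorname{Ann}(M)$.
   Context: Rings are commutative with identity; $l(-)$ denotes length and $\mu(M)$ the minimal number of generators of $M$. For a nonzero finitely generated module $M$ of dimension $t$ over a Noetherian local ring $(R,\mathfrak m)$ and an ideal $I$ with $\sqrt{I+\operatorname{Ann}(M)}=\mathfrak m$, $e(I,M)=\lim_{n\to\infty} t!\,\frac{l_R(M/I^nM)}{n^t}$ (normalized by $t=\dim M$). Define $$n(M)=\sup_{\sqrt{I+\operatorname{Ann}(M)}=\mathfrak m}\left\{\frac{l(M/IM)}{e(I,M)}\right\},$$ the supremum over all ideals $I$ of $R$ with $\sqrt{I+\operatorname{Ann}(M)}=\mathfrak m$; $n(\overline R)$ is this invariant for $\overline R$ as a module over itself. $\operatorname{Assh}(N)=\{P\in\operatorname{Ass}(N)\mid \dim(R/P)=\dim N\}$. $M$ is quasi-unmixed if its $\mathfrak m$-adic completion $\widehat M$ is equidimensional. *)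

(* Defs.v *)
From HB Require Import structures.
From mathcomp Require Import all_boot all_order all_algebra.
From mathcomp Require Import ring.
From mathcomp Require Import boolp classical_sets reals ereal topology normedtype sequences.

Set Implicit Arguments.
Unset Strict Implicit.
Unset Printing Implicit Defensive.

Import Order.TTheory GRing.Theory Num.Theory.
Local Open Scope classical_set_scope.
Local Open Scope ring_scope.
Local Open Scope quotient_scope.

(* MathComp's predicates are boolean; since excluded middle is available,
   [submodClosed V] is the type of all submodules of V. *)
Notation ideal A := (submodClosed (GRing.regular A)).

Section Submodules.
Variables (A : comPzRingType) (V : lmodType A).

Definition submod_zmod (N : submodClosed V) : {pred V} := fun x => x \in N.
Fact submod_zmod_closed N : zmod_closed (submod_zmod N).
Proof.
split; first exact: rpred0.
by move=> x y xN yN; rewrite -scaleN1r; apply: rpredD => //; apply: rpredZ.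
Qed.
HB.instance Definition _ N :=
  GRing.isZmodClosed.Build V (submod_zmod N) (submod_zmod_closed N).

Definition whole : {pred V} := fun _ => true.
Fact whole_closed : submod_closed whole. Proof. by []. Qed.
HB.instance Definition _ := GRing.isSubmodClosed.Build A V whole whole_closed.

Definition spanm (S : set V) : {pred V} :=
  fun x => `[< forall N : submodClosed V, S `<=` [set y | y \in N] -> x \in N >].
Fact spanm_closed S : submod_closed (spanm S).
Proof.
split; first by apply/asboolP => N _; rewrite rpred0.
move=> a x y /asboolP xS /asboolP yS; apply/asboolP => N SN.
by rewrite rpredD ?rpredZ ?xS ?yS.
Qed.
HB.instance Definition _ S :=
  GRing.isSubmodClosed.Build A V (spanm S) (spanm_closed S).

Lemma mem_spanm (S : set V) x : S x -> x \in spanm S.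
Proof. by move=> Sx; apply/asboolP => N; apply. Qed.

Definition addm (N1 N2 : submodClosed V) : submodClosed V :=
  spanm [set x | x \in N1 \/ x \in N2].

Definition smul (I : ideal A) (N : submodClosed V) : submodClosed V :=
  spanm [set v | exists a x, [/\ a \in I, x \in N & v = a *: x]].

Definition ann : {pred A^o} := fun a => `[< forall x : V, (a : A) *: x = 0 >].
Fact ann_closed : submod_closed ann.
Proof.
split; first by apply/asboolP => x; rewrite scale0r.
move=> a b c /asboolP bA /asboolP cA; apply/asboolP => x.
by rewrite scalerDl -scalerA bA cA scaler0 addr0.
Qed.
HB.instance Definition _ := GRing.isSubmodClosed.Build A A^o ann ann_closed.

Definition generates (s : seq V) :=
  forall x : V, x \in spanm [set y | y \in s].

Definition fin_gen := exists s, generates s.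

(* This is 0 when V is not finitely generated. *)
Definition mu : nat := infimum 0%N [set size s | s in generates].

End Submodules.

Arguments whole {A} V.
Arguments ann {A} V.
Arguments mu {A} V.
Arguments fin_gen {A} V.

Section QuotientModule.
Variables (A : comPzRingType) (V : lmodType A) (N : submodClosed V).

Definition qmod : Type := Quotient.quot (submod_zmod N).
HB.instance Definition _ := GRing.Zmodule.on qmod.

Definition qmod_pi (x : V) : qmod := \pi_(Quotient.quot (submod_zmod N)) x.
Definition qmod_repr (x : qmod) : V :=
  repr (x : Quotient.quot (submod_zmod N)).

Lemma qmod_reprK x : qmod_pi (qmod_repr x) = x.
Proof. exact: reprK. Qed.

Lemma qmod_piP x y : qmod_pi x = qmod_pi y <-> x - y \in N.
Proof.
have E := @Quotient.idealrBE V (submod_zmod N) x y.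
by split => [h | xyN]; [rewrite [_ \in _]E; apply/eqP | apply/eqP; rewrite -E].
Qed.

Lemma qmod_piD x y : qmod_pi (x + y) = qmod_pi x + qmod_pi y.
Proof. by rewrite /qmod_pi; exact: raddfD. Qed.

Lemma qmod_pi0 : qmod_pi 0 = 0.
Proof. by rewrite /qmod_pi; exact: raddf0. Qed.

Definition qmod_scale (a : A) (x : qmod) : qmod := qmod_pi (a *: qmod_repr x).

Lemma qmod_scale_pi a x : qmod_scale a (qmod_pi x) = qmod_pi (a *: x).
Proof.
by apply/qmod_piP; rewrite -scalerBr rpredZ //; apply/qmod_piP; rewrite qmod_reprK.
Qed.

Fact qmod_scaleA a b x : qmod_scale a (qmod_scale b x) = qmod_scale (a * b) x.
Proof. by rewrite -[x]qmod_reprK !qmod_scale_pi scalerA. Qed.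
Fact qmod_scale1 : left_id 1 qmod_scale.
Proof. by move=> x; rewrite -[x]qmod_reprK qmod_scale_pi scale1r. Qed.
Fact qmod_scaleDr : right_distributive qmod_scale +%R.
Proof.
move=> a x y; rewrite -[x]qmod_reprK -[y]qmod_reprK.
by rewrite -qmod_piD !qmod_scale_pi scalerDr qmod_piD.
Qed.
Fact qmod_scaleDl x : {morph qmod_scale^~ x : a b / a + b}.
Proof.
by move=> a b; rewrite -[x]qmod_reprK !qmod_scale_pi scalerDl qmod_piD.
Qed.
HB.instance Definition _ := GRing.Zmodule_isLmodule.Build A qmod
  qmod_scaleA qmod_scale1 qmod_scaleDr qmod_scaleDl.

End QuotientModule.

Arguments qmod_pi {A V} N x.
Arguments qmod_repr {A V N} x.

Section QuotientRing.
Variables (A : comPzRingType) (I : ideal A).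

Definition qring : Type := qmod I.
HB.instance Definition _ := GRing.Zmodule.on qring.

Definition qring_pi (a : A) : qring := qmod_pi I a.
Definition qring_repr (x : qring) : A := qmod_repr (x : qmod I).

Lemma qring_reprK x : qring_pi (qring_repr x) = x.
Proof. exact: qmod_reprK. Qed.
Lemma qring_piP a b : qring_pi a = qring_pi b <-> a - b \in I.
Proof. exact: qmod_piP. Qed.
Lemma qring_piD a b : qring_pi (a + b) = qring_pi a + qring_pi b.
Proof. exact: qmod_piD. Qed.

Definition qring_one : qring := qring_pi 1.
Definition qring_mul (x y : qring) : qring :=
  qring_pi (qring_repr x * qring_repr y).

Lemma idealMl (a b : A) : b \in I -> a * b \in I.
Proof. by move=> bI; exact: (rpredZ a bI). Qed.
Lemma idealD (a b : A) : a \in I -> b \in I -> a + b \in I.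
Proof. by move=> aI bI; exact: (rpredD aI bI). Qed.

Lemma qring_mul_pi a b : qring_mul (qring_pi a) (qring_pi b) = qring_pi (a * b).
Proof.
have reprE c : qring_repr (qring_pi c) - c \in I.
  by apply/qring_piP; rewrite qring_reprK.
apply/qring_piP; set a' := qring_repr _; set b' := qring_repr _.
have -> : a' * b' - a * b = a' * (b' - b) + b * (a' - a).
  by rewrite !mulrBr (mulrC b a') (mulrC b a) addrA subrK.
by apply: idealD; apply: idealMl; apply: reprE.
Qed.

Fact qring_mulA : associative qring_mul.
Proof.
move=> x y z; rewrite -[x]qring_reprK -[y]qring_reprK -[z]qring_reprK.
by rewrite !qring_mul_pi mulrA.
Qed.
Fact qring_mulC : commutative qring_mul.
Proof. by move=> x y; rewrite /qring_mul mulrC. Qed.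
Fact qring_mul1 : left_id qring_one qring_mul.
Proof. by move=> x; rewrite -[x]qring_reprK qring_mul_pi mul1r. Qed.
Fact qring_mulDl : left_distributive qring_mul +%R.
Proof.
move=> x y z; rewrite -[x]qring_reprK -[y]qring_reprK -[z]qring_reprK.
by rewrite -qring_piD !qring_mul_pi mulrDl qring_piD.
Qed.
HB.instance Definition _ := GRing.Zmodule_isComPzRing.Build qring
  qring_mulA qring_mulC qring_mul1 qring_mulDl.

(* The extension of J to A/I. *)
Definition image_ideal (J : ideal A) : ideal qring :=
  @spanm qring qring^o [set qring_pi x | x in [set x : A | x \in J]].

End QuotientRing.

Arguments qring_pi {A} I a.
Arguments qring_repr {A I} x.

Section Primes.
Variable A : comPzRingType.

Definition proper (I : ideal A) : Prop := (1 : A) \notin I.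

Definition is_prime (P : ideal A) : Prop :=
  proper P /\ forall a b : A, a * b \in P -> a \in P \/ b \in P.

Record spec := Spec { prime_ideal : ideal A; _ : is_prime prime_ideal }.

Definition is_maximal (I : ideal A) : Prop :=
  proper I /\
  forall J : ideal A, {subset I <= J} -> proper J -> {subset J <= I}.

Definition is_local (m : ideal A) : Prop :=
  is_maximal m /\ forall m' : ideal A, is_maximal m' -> m' =i m.

Definition radical (I : ideal A) : set A := [set x | exists n, x ^+ n \in I].

Definition noetherian : Prop := forall I : ideal A,
  exists s : seq A^o, I =i spanm [set x | x \in s].

Fixpoint ipow (I : ideal A) (n : nat) : ideal A :=
  if n is k.+1 then smul I (ipow I k) else whole A^o.

End Primes.

Arguments spec : clear implicits.
Arguments noetherian : clear implicits.
Coercion prime_ideal : spec >-> GRing.SubmodClosed.type.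

Section Localization.
Variables (A : comPzRingType) (P : spec A).

Definition fraction := (A * {s : A | s \notin P})%type.
HB.instance Definition _ := Choice.on fraction.
Implicit Types x y z : fraction.

Definition den x : A := val x.2.

Lemma spec1 : (1 : A) \notin P. Proof. by case: P => I []. Qed.
Lemma specM (s t : A) : s \notin P -> t \notin P -> s * t \notin P.
Proof.
case: P => I [I1 IM] /= sI tI; apply/negP => /IM[h|h].
  by rewrite h in sI.
by rewrite h in tI.
Qed.
Lemma denP x : den x \notin P. Proof. exact: valP x.2. Qed.

Definition frac_eq : rel fraction := fun x y =>
  `[< exists2 u : A, u \notin P & u * (x.1 * den y - y.1 * den x) = 0 >].

Lemma frac_refl : reflexive frac_eq.
Proof.
by move=> x; apply/asboolP; exists 1; [exact: spec1 | rewrite subrr mulr0].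
Qed.
Lemma frac_sym : symmetric frac_eq.
Proof.
move=> x y; apply/asboolP/asboolP => -[u uP uE]; exists u => //;
  by rewrite -opprB mulrN uE oppr0.
Qed.
Lemma frac_trans : transitive frac_eq.
Proof.
move=> y x z /asboolP[u uP uE] /asboolP[v vP vE]; apply/asboolP.
exists (u * v * den y); first by rewrite !specM ?denP.
have -> : u * v * den y * (x.1 * den z - z.1 * den x) =
    v * den z * (u * (x.1 * den y - y.1 * den x)) +
    u * den x * (v * (y.1 * den z - z.1 * den y)) by ring.
by rewrite uE vE !mulr0 addr0.
Qed.
Canonical frac_equiv := EquivRel frac_eq frac_refl frac_sym frac_trans.

Definition loc : Type := {eq_quot frac_eq}.
HB.instance Definition _ := Choice.on loc.

Definition loc_pi x : loc := \pi_{eq_quot frac_eq} x.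
Definition loc_repr (q : loc) : fraction := repr (q : {eq_quot frac_eq}).
Lemma loc_reprK q : loc_pi (loc_repr q) = q. Proof. exact: reprK. Qed.
Lemma loc_piP x y : loc_pi x = loc_pi y <-> frac_eq x y.
Proof. by split => [/eqmodP|?]; last exact/eqmodP. Qed.

Definition mkfrac (a s : A) (sP : s \notin P) : fraction := (a, exist _ s sP).

Definition frac_add x y : fraction :=
  mkfrac (x.1 * den y + y.1 * den x) (specM (denP x) (denP y)).
Definition frac_mul x y : fraction :=
  mkfrac (x.1 * y.1) (specM (denP x) (denP y)).
Definition frac_opp x : fraction := (- x.1, x.2).

Definition loc_zero : loc := loc_pi (mkfrac 0 spec1).
Definition loc_one : loc := loc_pi (mkfrac 1 spec1).
Definition loc_add (p q : loc) := loc_pi (frac_add (loc_repr p) (loc_repr q)).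
Definition loc_mul (p q : loc) := loc_pi (frac_mul (loc_repr p) (loc_repr q)).
Definition loc_opp (p : loc) := loc_pi (frac_opp (loc_repr p)).

Lemma frac_eqW x y : x.1 * den y = y.1 * den x -> frac_eq x y.
Proof.
by move=> e; apply/asboolP; exists 1; [exact: spec1 | rewrite e subrr mulr0].
Qed.

Lemma loc_pi_eq x : frac_eq (loc_repr (loc_pi x)) x.
Proof. by apply/loc_piP; rewrite loc_reprK. Qed.

Lemma loc_add_pi x y : loc_add (loc_pi x) (loc_pi y) = loc_pi (frac_add x y).
Proof.
apply/loc_piP/asboolP; move: (loc_pi_eq x) (loc_pi_eq y).
move: (loc_repr _) (loc_repr _) => y' x' /asboolP[u uP uE] /asboolP[v vP vE].
exists (u * v); first exact: specM.
transitivity (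
    v * den y * den y' * (u * (x'.1 * den x - x.1 * den x')) +
    u * den x * den x' * (v * (y'.1 * den y - y.1 * den y')));
  last by rewrite uE vE !mulr0 addr0.
by rewrite /frac_add /den /=; ring.
Qed.
Lemma loc_mul_pi x y : loc_mul (loc_pi x) (loc_pi y) = loc_pi (frac_mul x y).
Proof.
apply/loc_piP/asboolP; move: (loc_pi_eq x) (loc_pi_eq y).
move: (loc_repr _) (loc_repr _) => y' x' /asboolP[u uP uE] /asboolP[v vP vE].
exists (u * v); first exact: specM.
transitivity (
    v * y'.1 * den y * (u * (x'.1 * den x - x.1 * den x')) +
    u * x.1 * den x' * (v * (y'.1 * den y - y.1 * den y')));
  last by rewrite uE vE !mulr0 addr0.
by rewrite /frac_mul /den /=; ring.
Qed.
Lemma loc_opp_pi x : loc_opp (loc_pi x) = loc_pi (frac_opp x).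
Proof.
apply/loc_piP/asboolP; move: (loc_pi_eq x).
move: (loc_repr _) => x' /asboolP[u uP uE].
exists u => //.
transitivity (
    - (u * (x'.1 * den x - x.1 * den x')));
  last by rewrite uE oppr0.
by rewrite /frac_opp /den /=; ring.
Qed.

Fact loc_addA : associative loc_add.
Proof.
move=> p q r; rewrite -[p]loc_reprK -[q]loc_reprK -[r]loc_reprK !loc_add_pi.
by apply/loc_piP/frac_eqW; rewrite /frac_add /den /=; ring.
Qed.
Fact loc_addC : commutative loc_add.
Proof.
move=> p q; rewrite -[p]loc_reprK -[q]loc_reprK !loc_add_pi.
by apply/loc_piP/frac_eqW; rewrite /frac_add /den /=; ring.
Qed.
Fact loc_add0 : left_id loc_zero loc_add.
Proof.
move=> p; rewrite -[p]loc_reprK loc_add_pi.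
by apply/loc_piP/frac_eqW; rewrite /frac_add /den /=; ring.
Qed.
Fact loc_addN : left_inverse loc_zero loc_opp loc_add.
Proof.
move=> p; rewrite -[p]loc_reprK loc_opp_pi loc_add_pi.
by apply/loc_piP/frac_eqW; rewrite /frac_add /frac_opp /den /=; ring.
Qed.
HB.instance Definition _ :=
  GRing.isZmodule.Build loc loc_addA loc_addC loc_add0 loc_addN.

Fact loc_mulA : associative loc_mul.
Proof.
move=> p q r; rewrite -[p]loc_reprK -[q]loc_reprK -[r]loc_reprK !loc_mul_pi.
by apply/loc_piP/frac_eqW; rewrite /frac_mul /den /=; ring.
Qed.
Fact loc_mulC : commutative loc_mul.
Proof.
move=> p q; rewrite -[p]loc_reprK -[q]loc_reprK !loc_mul_pi.
by apply/loc_piP/frac_eqW; rewrite /frac_mul /den /=; ring.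
Qed.
Fact loc_mul1 : left_id loc_one loc_mul.
Proof.
move=> p; rewrite -[p]loc_reprK loc_mul_pi.
by apply/loc_piP/frac_eqW; rewrite /frac_mul /den /=; ring.
Qed.
Fact loc_mulDl : left_distributive loc_mul loc_add.
Proof.
move=> p q r; rewrite -[p]loc_reprK -[q]loc_reprK -[r]loc_reprK.
rewrite loc_add_pi !loc_mul_pi loc_add_pi.
by apply/loc_piP/frac_eqW; rewrite /frac_add /frac_mul /den /=; ring.
Qed.
HB.instance Definition _ := GRing.Zmodule_isComPzRing.Build loc
  loc_mulA loc_mulC loc_mul1 loc_mulDl.

End Localization.

Section Completion.
Variables (A : comPzRingType) (I : ideal A).

Section Module.
Variable V : lmodType A.

Definition powm n : submodClosed V := smul (ipow I n) (whole V).

Definition transition n (x : qmod (powm n.+1)) : qmod (powm n) :=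
  qmod_pi (powm n) (qmod_repr x).

(* The inverse limit of the V/I^nV. *)
Record compl_mod := ComplMod {
  coord :> forall n, qmod (powm n);
  coordP : forall n, transition (coord n.+1) = coord n }.

HB.instance Definition _ := gen_eqMixin compl_mod.
HB.instance Definition _ := gen_choiceMixin compl_mod.

Lemma compl_modP (x y : compl_mod) : (forall n, x n = y n) -> x = y.
Proof.
case: x y => [x xP] [y yP] /= e.
have {}e : x = y by apply: functional_extensionality_dep.
by case: _ / e yP => yP; congr ComplMod; apply: Prop_irrelevance.
Qed.

Lemma powmS n x : x \in powm n.+1 -> x \in powm n.
Proof.
move=> /asboolP; apply=> _ [a [y [aI _ ->]]] /=.
apply: mem_spanm; exists a, y; split=> //.
move: aI; rewrite /= => /asboolP; apply=> _ [b [c [bI cI ->]]] /=.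
exact: idealMl.
Qed.

Lemma transition_pi n x :
  @transition n (qmod_pi (powm n.+1) x) = qmod_pi (powm n) x.
Proof. by apply/qmod_piP/powmS/qmod_piP; rewrite qmod_reprK. Qed.
Lemma transitionD n : {morph @transition n : x y / x + y}.
Proof.
move=> x y; rewrite -[x]qmod_reprK -[y]qmod_reprK.
by rewrite -qmod_piD !transition_pi qmod_piD.
Qed.
Lemma transitionZ n (a : A) : {morph @transition n : x / a *: x}.
Proof.
move=> x; rewrite -[x]qmod_reprK.
by rewrite [_ *: _]qmod_scale_pi !transition_pi -qmod_scale_pi.
Qed.

Fact compl_addP (x y : compl_mod) n :
  transition (x n.+1 + y n.+1) = x n + y n.
Proof. by apply: etrans (transitionD _ _) _; rewrite (coordP x n) (coordP y n). Qed.
Fact compl_oppP (x : compl_mod) n : transition (- x n.+1) = - x n.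
Proof.
rewrite -!scaleN1r; apply: etrans (transitionZ _ _) _.
by rewrite (coordP x n).
Qed.
Fact compl_zeroP n : transition (0 : qmod (powm n.+1)) = 0.
Proof. by rewrite -!qmod_pi0; exact: transition_pi. Qed.

Definition compl_add x y := ComplMod (compl_addP x y).
Definition compl_opp x := ComplMod (compl_oppP x).
Definition compl_zero := ComplMod compl_zeroP.

Fact compl_addA : associative compl_add.
Proof. by move=> x y z; apply: compl_modP => n /=; rewrite addrA. Qed.
Fact compl_addC : commutative compl_add.
Proof. by move=> x y; apply: compl_modP => n /=; rewrite addrC. Qed.
Fact compl_add0 : left_id compl_zero compl_add.
Proof. by move=> x; apply: compl_modP => n /=; rewrite add0r. Qed.
Fact compl_addN : left_inverse compl_zero compl_opp compl_add.
Proof. by move=> x; apply: compl_modP => n /=; rewrite addNr. Qed.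
HB.instance Definition _ := GRing.isZmodule.Build compl_mod
  compl_addA compl_addC compl_add0 compl_addN.

Lemma powm_act n (a b : A) (v : qmod (powm n)) :
  a - b \in smul (ipow I n) (whole A^o) -> a *: v = b *: v.
Proof.
move=> abI; apply/eqP; rewrite -subr_eq0 -scalerBl; apply/eqP.
suff : a - b \in ann (qmod (powm n)) by move/asboolP.
move/asboolP: abI; apply=> _ [c [d [cI _ ->]]] /=.
apply/asboolP => w; rewrite -[w]qmod_reprK [_ *: _]qmod_scale_pi -qmod_pi0.
apply/qmod_piP; rewrite subr0 -[c *: d]/(c * d) -scalerA.
by apply: mem_spanm; exists c, (d *: qmod_repr w).
Qed.

End Module.

Definition compl_ring : Type := compl_mod A^o.
HB.instance Definition _ := GRing.Zmodule.on compl_ring.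

Definition coordr (x : compl_ring) n : qring (powm A^o n) :=
  coord (x : compl_mod A^o) n.

Lemma transition_mul n (a b : qring (powm A^o n.+1)) :
  transition (a * b : qring _) =
  (transition a : qring (powm A^o n)) * (transition b : qring (powm A^o n)).
Proof.
rewrite -[a]qring_reprK -[b]qring_reprK [_ * _]qring_mul_pi.
rewrite /qring_pi !transition_pi; apply/esym; exact: qring_mul_pi.
Qed.

Fact compl_mulP (x y : compl_ring) n :
  transition (coordr x n.+1 * coordr y n.+1 : qring _) =
  coordr x n * coordr y n :> qring _.
Proof.
apply: etrans (transition_mul _ _) _.
by congr (_ * _ : qring _); apply: coordP.
Qed.
Fact compl_oneP n :
  transition (1 : qring (powm A^o n.+1)) = (1 : qring (powm A^o n)).
Proof. exact: transition_pi. Qed.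

Definition compl_mul (x y : compl_ring) : compl_ring := ComplMod (compl_mulP x y).
Definition compl_one : compl_ring := ComplMod compl_oneP.

Fact compl_mulA : associative compl_mul.
Proof. by move=> x y z; apply: compl_modP => n; exact: (@mulrA (qring (powm A^o n)) (coordr x n) (coordr y n) (coordr z n)). Qed.
Fact compl_mulC : commutative compl_mul.
Proof. by move=> x y; apply: compl_modP => n; exact: (@mulrC (qring (powm A^o n)) (coordr x n) (coordr y n)). Qed.
Fact compl_mul1 : left_id compl_one compl_mul.
Proof. by move=> x; apply: compl_modP => n; exact: (@mul1r (qring (powm A^o n)) (coordr x n)). Qed.
Fact compl_mulDl : left_distributive compl_mul +%R.
Proof. by move=> x y z; apply: compl_modP => n; exact: (@mulrDl (qring (powm A^o n)) (coordr x n) (coordr y n) (coordr z n)). Qed.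
HB.instance Definition _ := GRing.Zmodule_isComPzRing.Build compl_ring
  compl_mulA compl_mulC compl_mul1 compl_mulDl.

Section Action.
Variable V : lmodType A.

Lemma qring_act_pi n (a : A) (v : qmod (powm V n)) :
  qring_repr (qring_pi (powm A^o n) a) *: v = a *: v.
Proof. by apply: powm_act; apply/qring_piP; rewrite qring_reprK. Qed.

Fact compl_scaleP (a : compl_ring) (x : compl_mod V) n :
  transition (qring_repr (coordr a n.+1) *: x n.+1) =
  qring_repr (coordr a n) *: x n.
Proof.
apply: etrans (transitionZ _ _) _; rewrite (coordP x n).
by apply/esym; rewrite -[coordr a n](coordP a n); exact: qring_act_pi.
Qed.

Definition compl_scale (a : compl_ring) (x : compl_mod V) : compl_mod V :=
  ComplMod (compl_scaleP a x).

Fact compl_scaleA a b x :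
  compl_scale a (compl_scale b x) = compl_scale (a * b) x.
Proof.
apply: compl_modP => n /=; rewrite scalerA; apply/esym.
exact: qring_act_pi.
Qed.
Fact compl_scale1 : left_id 1 compl_scale.
Proof.
move=> x; apply: compl_modP => n /=; rewrite -[RHS]scale1r.
exact: qring_act_pi.
Qed.
Fact compl_scaleDr : right_distributive compl_scale +%R.
Proof. by move=> a x y; apply: compl_modP => n /=; rewrite scalerDr. Qed.
Fact compl_scaleDl x : {morph compl_scale^~ x : a b / a + b}.
Proof.
move=> a b; apply: compl_modP => n /=; rewrite -scalerDl -[RHS]qring_act_pi.
by rewrite qring_piD !qring_reprK.
Qed.
HB.instance Definition _ := GRing.Zmodule_isLmodule.Build compl_ring (compl_mod V)
  compl_scaleA compl_scale1 compl_scaleDr compl_scaleDl.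

End Action.
End Completion.

Section Invariants.

(* Supremum in {-oo} + nat + {+oo}; the supremum of the empty set is -oo. *)
Definition nat_sup (S : set nat) : \bar nat :=
  if S == set0 then -oo%E
  else if `[< has_ubound S >] then (supremum 0%N S)%:E else +oo%E.

Definition strict_sub (A : comPzRingType) (V : lmodType A)
    (N1 N2 : submodClosed V) : Prop :=
  {subset N1 <= N2} /\ ~ {subset N2 <= N1}.

Definition length (A : comPzRingType) (V : lmodType A) : \bar nat :=
  nat_sup [set k | exists N : nat -> submodClosed V,
                     forall i, (i < k)%N -> strict_sub (N i) (N i.+1)].

Definition kdim (A : comPzRingType) : \bar nat :=
  nat_sup [set k | exists P : nat -> spec A,
                     forall i, (i < k)%N -> strict_sub (P i) (P i.+1)].

Definition mdim (A : comPzRingType) (V : lmodType A) : \bar nat :=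
  kdim (qring (ann V)).

Definition Ass (A : comPzRingType) (V : lmodType A) : spec A -> Prop :=
  fun P => exists x : V, forall a : A, a \in P <-> a *: x = 0.

Definition Assh (A : comPzRingType) (V : lmodType A) : spec A -> Prop :=
  fun P => Ass V P /\ kdim (qring P) = mdim V.

Definition min_prime (A : comPzRingType) (I : ideal A) : spec A -> Prop :=
  fun P => {subset I <= P} /\
    forall Q : spec A, {subset I <= Q} -> {subset Q <= P} -> {subset P <= Q}.

(* The minimal primes of the support of a finitely generated module are the
   minimal primes over its annihilator. *)
Definition equidimensional (A : comPzRingType) (V : lmodType A) : Prop :=
  forall P : spec A, min_prime (ann V) P -> kdim (qring P) = mdim V.

Definition quasi_unmixed (A : comPzRingType) (m : ideal A) (V : lmodType A) :=
  @equidimensional (compl_ring m) (compl_mod m V).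

Variable K : realType.
Local Open Scope ereal_scope.

Definition len (A : comPzRingType) (V : lmodType A) : \bar K :=
  er_map (fun n => n%:R) (length V).

(* This is 0 when the dimension of V is not a natural number. *)
Definition dimn (A : comPzRingType) (V : lmodType A) : nat :=
  if mdim V is n%:E then n else 0%N.

Definition multiplicity (A : comPzRingType) (I : ideal A) (V : lmodType A) :
    \bar K :=
  let t := dimn V in
  limn (fun n => (t`!%:R / n%:R ^+ t)%R%:E * len (qmod (powm I V n))).

Definition m_cofinite (A : comPzRingType) (m : ideal A) (V : lmodType A) :
    ideal A -> Prop :=
  fun I => radical (addm I (ann V)) = [set x : A | x \in m].

(* Here m is meant to be the maximal ideal of the local ring A. *)
Definition n_inv (A : comPzRingType) (m : ideal A) (V : lmodType A) : \bar K :=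
  ereal_sup [set r | exists2 I, m_cofinite m V I &
    r = len (qmod (smul I (whole V))) / multiplicity I V].

(* For a Noetherian local ring A, Assh A is finite and nonempty, so that the
   supremum is a maximum. *)
Definition max_loc_length (A : comPzRingType) : \bar K :=
  ereal_sup [set r | exists2 P : spec A, Assh A^o P & r = len (loc P)^o].

End Invariants.

(* Main.v *)
(** Let I be an ideal and H_Q(n) the length of Rbar / (Q + I^n). A finitely generated
    Rbar-module V has a filtration with factors Rbar / Q_i, all Q_i prime, and by Artin-Rees
    the length of V / I^n V lies between sum_i H_{Q_i}(n - c) and sum_i H_{Q_i}(n). As H_Q is
    eventually a polynomial of degree at most dim Rbar / Q, this shows that e(I, V) is the sum,
    over the Q_i with dim Rbar / Q_i = t = dim Rbar, of the limits of t! H_{Q_i}(n) / n^t.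
    For V = Rbar those primes are in Assh Rbar and Q occurs at most l(Rbar_Q) <= c times;
    for the faithful module V = M each of them occurs at least once. Hence
    e(I, Rbar) <= c e(I, M), and the claim follows from l(M/IM) <= mu(M) l(Rbar / I Rbar). *)

Require Import Defs.
From HB Require Import structures.
From mathcomp Require Import all_boot all_order all_algebra.
From mathcomp Require Import ring zify.
From mathcomp Require Import boolp classical_sets reals ereal topology normedtype sequences.

Set Implicit Arguments.
Unset Strict Implicit.
Unset Printing Implicit Defensive.

Import Order.TTheory GRing.Theory Num.Theory.
Import numFieldNormedType.Exports.
Local Open Scope classical_set_scope.
Local Open Scope ring_scope.

(** Two opposite estimates of the degree of H_Q are needed. Strict chains of primes force the degree
    up; as the degree is at most the number of generators of I, this makes dim Rbar finite. A system
    of parameters chosen inside I keeps the degree at most dim Rbar / Q, so that only primes of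
    dimension t contribute to the limit. A prime of dimension t has no prime strictly below it.
    Hence it is associated to Rbar, and it equals any filtration prime of M that it contains;
    faithfulness of M supplies one. An occurrence of Q among the factors of Rbar gives a strict
    inclusion after localization at Q, which is why l(Rbar_Q) bounds their number. Eventual
    polynomiality, rather than a mere growth bound, makes the limits exist and the Artin-Rees shift
    n - c disappear in them. Lengths are taken between submodules given as sets, so that neither
    graded rings nor quotient modules have to be formed. All invariants are extended reals, with 1/0
    = +oo: the cases c = +oo and e(I, Rbar) = 0 are treated directly instead of being excluded. *)

(* 0 if S is empty or unbounded. *)
Definition natmax (S : set nat) : nat :=
  xget 0%N [set b | S b /\ forall k, S k -> (k <= b)%N].

Lemma natmaxP (S : set nat) b : S !=set0 -> (forall k, S k -> (k <= b)%N) ->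
  S (natmax S) /\ forall k, S k -> (k <= natmax S)%N.
Proof.
move=> [k0 Sk0] hb.
suff [c hc] : exists c, S c /\ forall k, S k -> (k <= c)%N.
  exact: (xgetPex 0%N (P := [set b | S b /\ forall k, S k -> (k <= b)%N]) (ex_intro _ c hc)).
elim: b hb => [|b IH] hb.
  exists k0; split=> // k Sk; have := hb k Sk; have := hb k0 Sk0; lia.
have [Sb|nSb] := pselect (S b.+1); first by exists b.+1.
apply: IH => k Sk; have := hb k Sk; rewrite leq_eqVlt ltnS => /orP[/eqP e|//].
by rewrite e in Sk.
Qed.

(** * Submodules as Prop-valued sets *)

Section SubmoduleSets.
Variables (A : comPzRingType) (V : lmodType A).
Implicit Types (U W T : set V) (x y v : V) (a b : A).

Definition submod U := U 0 /\ forall a x y, U x -> U y -> U (a *: x + y).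

Lemma submod0 U : submod U -> U 0. Proof. by case. Qed.
Lemma submodZ U a x : submod U -> U x -> U (a *: x).
Proof. by move=> [U0 h] Ux; rewrite -[_ *: _]addr0; apply: h. Qed.
Lemma submodD U x y : submod U -> U x -> U y -> U (x + y).
Proof. by move=> [U0 h] Ux Uy; rewrite -[x]scale1r; apply: h. Qed.
Lemma submodN U x : submod U -> U x -> U (- x).
Proof. by move=> sU Ux; rewrite -scaleN1r; apply: submodZ. Qed.
Lemma submodB U x y : submod U -> U x -> U y -> U (x - y).
Proof. by move=> sU Ux Uy; apply: submodD => //; apply: submodN. Qed.
Lemma submodDr U x y : submod U -> U x -> U (x + y) -> U y.
Proof. by move=> sU Ux Uxy; rewrite -[y](addKr x) addrC; apply: submodB. Qed.
Lemma submodDl U x y : submod U -> U y -> U (x + y) -> U x.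
Proof. by move=> sU Uy; rewrite addrC; apply: submodDr. Qed.

Lemma submodT : submod setT. Proof. by []. Qed.
Lemma submod_zero : submod [set 0].
Proof. by split=> // a x y -> ->; rewrite scaler0 addr0. Qed.
Lemma submodI U W : submod U -> submod W -> submod (U `&` W).
Proof. by move=> [U0 hU] [W0 hW]; split=> // a x y [? ?] [? ?]; split; auto. Qed.

Lemma submod_mem (N : submodClosed V) : submod [set x | x \in N].
Proof.
by split=> [|a x y xN yN]; rewrite /= ?rpred0 // rpredD ?rpredZ.
Qed.

(** [spanm] quantifies over bundled submodules, so U is repackaged as one through the boolean
    reflection of its membership. *)
Lemma mem_spanmP U : submod U -> [set x | x \in spanm U] = U.
Proof.
move=> [U0 hU]; apply/seteqP; split=> x; last exact: mem_spanm.
pose f : {pred V} := fun x => `[< U x >].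
have fc : submod_closed f.
  split; first by apply/asboolP.
  by move=> a u v /asboolP Uu /asboolP Uv; apply/asboolP; apply: hU.
pose F : submodClosed V := HB.pack f (GRing.isSubmodClosed.Build A V f fc).
by move=> /asboolP /(_ F) h; apply/asboolP/h => y Uy; apply/asboolP.
Qed.

Lemma spanm_sub (S U : set V) : submod U -> S `<=` U ->
  [set x | x \in spanm S] `<=` U.
Proof.
move=> sU SU x /asboolP /(_ (spanm U)) h; rewrite -(mem_spanmP sU); apply: h.
by move=> y Sy; apply/mem_spanm/SU.
Qed.

Definition sadd U W : set V := [set x | exists u w, [/\ U u, W w & x = u + w]].
Definition line v : set V := [set x | exists a, x = a *: v].
Definition colon W v : set A^o := [set a : A^o | W ((a : A) *: v)].

Lemma submod_sadd U W : submod U -> submod W -> submod (sadd U W).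
Proof.
move=> sU sW; split; first by exists 0, 0; rewrite addr0; split=> //; apply: submod0.
move=> a _ _ [u [w [Uu Ww ->]]] [u' [w' [Uu' Ww' ->]]].
exists (a *: u + u'), (a *: w + w'); split; [exact: sU.2|exact: sW.2|].
by rewrite scalerDr addrACA.
Qed.

Lemma submod_line v : submod (line v).
Proof.
split; first by exists 0; rewrite scale0r.
by move=> a _ _ [b ->] [c ->]; exists (a * b + c); rewrite scalerDl scalerA.
Qed.

Lemma line_id v : line v v. Proof. by exists 1; rewrite scale1r. Qed.

Lemma sub_line U v : submod U -> U v -> line v `<=` U.
Proof. by move=> sU Uv _ [a ->]; apply: submodZ. Qed.

Lemma sadd_l U W : submod W -> U `<=` sadd U W.
Proof. by move=> sW u Uu; exists u, 0; rewrite addr0; split=> //; apply: submod0. Qed.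
Lemma sadd_r U W : submod U -> W `<=` sadd U W.
Proof. by move=> sU w Ww; exists 0, w; rewrite add0r; split=> //; apply: submod0. Qed.
Lemma sadd_sub U W T : submod T -> U `<=` T -> W `<=` T -> sadd U W `<=` T.
Proof. by move=> sT UT WT _ [u [w [/UT Tu /WT Tw ->]]]; apply: submodD. Qed.
Lemma sadd_mono U U' W W' : U `<=` U' -> W `<=` W' -> sadd U W `<=` sadd U' W'.
Proof. by move=> UU WW _ [u [w [/UU Uu /WW Ww ->]]]; exists u, w. Qed.
Lemma saddC U W : sadd U W = sadd W U.
Proof.
by apply/seteqP; split=> _ [u [w [Uu Ww ->]]]; exists w, u; rewrite addrC.
Qed.
Lemma saddA U W T : sadd U (sadd W T) = sadd (sadd U W) T.
Proof.
apply/seteqP; split.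
  move=> _ [u [_ [Uu [w [t [Ww Tt ->]]] ->]]]; exists (u + w), t.
  by rewrite addrA; split=> //; exists u, w.
move=> _ [_ [t [[u [w [Uu Ww ->]]] Tt ->]]]; exists u, (w + t).
by rewrite addrA; split=> //; exists w, t.
Qed.
Lemma sadd_absorb U W : submod U -> submod W -> U `<=` W -> sadd U W = W.
Proof.
move=> sU sW UW; apply/seteqP; split; last exact: sadd_r.
by apply: sadd_sub.
Qed.

End SubmoduleSets.

Lemma lin0 (A : comPzRingType) (V V' : lmodType A) (f : V -> V') :
  (forall a x y, f (a *: x + y) = a *: f x + f y) -> f 0 = 0.
Proof.
move=> lf; have := lf 1 0 0; rewrite !scale1r addr0.
by move=> /(congr1 (fun z => z - f 0)); rewrite addrK subrr.
Qed.

Lemma submod_preim (A : comPzRingType) (V V' : lmodType A) (f : V -> V')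
  (U : set V) (W : set V') :
  (forall a x y, f (a *: x + y) = a *: f x + f y) -> submod U -> submod W ->
  submod [set u | U u /\ W (f u)].
Proof.
move=> lf sU sW; have f0 := lin0 lf.
split; first by rewrite /= f0; split; apply: submod0.
by move=> a x y [Ux Wx] [Uy Wy]; rewrite /= lf; split; [apply: sU.2|apply: sW.2].
Qed.

Lemma submod_im (A : comPzRingType) (V V' : lmodType A) (f : V -> V')
  (U : set V) :
  (forall a x y, f (a *: x + y) = a *: f x + f y) -> submod U ->
  submod (f @` U).
Proof.
move=> lf sU; have f0 := lin0 lf.
split; first by exists 0 => //; apply: submod0.
move=> a _ _ [x Ux <-] [y Uy <-]; exists (a *: x + y); first exact: sU.2.
exact: lf.
Qed.

(** * Lengths of subquotients, measured by chains *)

Section Length.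
Variables (A : comPzRingType) (V : lmodType A).
Implicit Types (U W T : set V) (v : V).

Definition ssub W U := W `<=` U /\ ~ U `<=` W.

(** The ends only have to lie between W and U, so that a chain stays a chain when the interval is
    widened. The greatest such k is the length of U / W, obtained without forming the quotient. *)
Definition chain W U k := exists N : nat -> set V,
  [/\ forall i, submod (N i), W `<=` N 0%N, N k `<=` U &
      forall i, (i < k)%N -> ssub (N i) (N i.+1)].

Lemma ssub_mono (N : nat -> set V) k : (forall i, (i < k)%N -> ssub (N i) (N i.+1)) ->
  forall i l, (i <= l)%N -> (l <= k)%N -> N i `<=` N l.
Proof.
move=> sm i; elim=> [|l IH] il lk; first by have -> : i = 0%N by lia.
move: il; rewrite leq_eqVlt => /orP[/eqP -> //|il] x Nx.
by have [h _] := sm l lk; apply/h/IH => //; apply: ltnW.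
Qed.

Definition finlen W U := exists b, forall k, chain W U k -> (k <= b)%N.

Definition ell W U : nat := natmax [set k | chain W U k].

Lemma chain_mono W W' U U' k : W' `<=` W -> U `<=` U' -> chain W U k -> chain W' U' k.
Proof.
move=> WW UU [N [sN WN NU sm]]; exists N; split=> //.
  exact: subset_trans WN.
exact: subset_trans UU.
Qed.

Lemma chain0 W U : submod W -> W `<=` U -> chain W U 0.
Proof. by move=> sW WU; exists (fun=> W); split. Qed.

Lemma chain_snoc W U U' k : chain W U k -> submod U' -> ssub U U' -> chain W U' k.+1.
Proof.
move=> [N [sN WN NU sm]] sU' [UU' nUU'].
exists (fun i => if (i <= k)%N then N i else U'); split.
- by move=> i; case: ifP.
- by [].
- by rewrite ltnn.
move=> i; rewrite ltnS => ik; rewrite ik.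
case: ifP => [|ik']; first exact: sm.
have -> : i = k by lia.
split; first exact: subset_trans NU UU'.
by move=> h; apply: nUU'; apply: subset_trans h NU.
Qed.

Lemma chain_cat W T U i j : chain W T i -> chain T U j -> chain W U (i + j).
Proof.
move=> cWT [N [sN TN NU sm]]; apply: (chain_mono _ NU) (_ : chain W (N j) _) => //.
have : (j <= j)%N by []; elim: {1 3 4}j => [|l IH] lj.
  by rewrite addn0; apply: chain_mono cWT.
by rewrite addnS; apply: chain_snoc (IH (ltnW lj)) (sN _) (sm _ lj).
Qed.

Lemma chain_cons W T U k : submod W -> submod T -> ssub W T -> chain T U k -> chain W U k.+1.
Proof.
move=> sW sT WT; rewrite -add1n; apply: chain_cat.
by apply: chain_snoc WT => //; apply: chain0.
Qed.

(* Modular law: each strict step stays strict after intersecting with, or after adding, T. *)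
Lemma chain_split W T U k : submod W -> submod T -> submod U -> W `<=` T -> T `<=` U ->
  chain W U k -> exists i j, [/\ (k <= i + j)%N, chain W T i & chain T U j].
Proof.
move=> sW sT sU WT TU [N [sN WN NU sm]].
have Nmono l := ssub_mono sm (leq0n l).
suff [i [j [kij c1 c2]]] : exists i j, [/\ (k <= i + j)%N,
    chain W (N k `&` T) i & chain T (sadd (N k) T) j].
  exists i, j; split=> //; first by apply: chain_mono c1 => // x [].
  by apply: chain_mono c2 => //; apply: sadd_sub.
have : (k <= k)%N by []; elim: {1 3 4 5}k => [|l IH] lk.
  exists 0%N, 0%N; split=> //; apply: chain0 => //.
    by move=> x Wx; split; [apply: WN|apply: WT].
  exact: sadd_r.
have [i [j [lij c1 c2]]] := IH (ltnW lk); have [Nl nNl] := sm l lk.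
have [h1|h1] := pselect (N l.+1 `&` T `<=` N l `&` T).
  exists i, j.+1; split; first by rewrite addnS.
    by apply: chain_mono c1 => //; apply: setSI.
  apply: (chain_snoc c2); first exact: submod_sadd.
  split; first exact: sadd_mono.
  move=> h2; apply: nNl => x Nx; have [|u [t [Nu Tt e]]] := h2 x.
    exact: sadd_l.
  rewrite e; apply: submodD => //.
  have [] // : (N l `&` T) t; apply: h1; split=> //.
  by apply: (@submodDr _ _ _ u) => //; [exact: Nl|rewrite -e].
exists i.+1, j; split; first by rewrite addSn.
  apply: (chain_snoc c1); first exact: submodI.
  by split=> //; apply: setSI.
by apply: chain_mono c2 => //; apply: sadd_mono.
Qed.

Lemma ellP W U : submod W -> W `<=` U -> finlen W U ->
  chain W U (ell W U) /\ forall k, chain W U k -> (k <= ell W U)%N.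
Proof.
move=> sW WU [b hb]; apply: (natmaxP (S := [set k | chain W U k]) (b := b)) => //.
by exists 0%N; apply: chain0.
Qed.

Lemma finlen_mono W W' U U' : W `<=` W' -> U' `<=` U -> finlen W U -> finlen W' U'.
Proof. by move=> WW UU [b hb]; exists b => k /(chain_mono WW UU); apply: hb. Qed.

Lemma finlen_trans W T U : submod W -> submod T -> submod U -> W `<=` T -> T `<=` U ->
  finlen W T -> finlen T U -> finlen W U.
Proof.
move=> sW sT sU WT TU [b hb] [c hc]; exists (b + c)%N => k.
move=> /(chain_split sW sT sU WT TU)[i [j [kij /hb ib /hc jc]]]; lia.
Qed.

(** Concatenating longest chains gives one inequality, splitting a longest chain at T gives the
    other. *)
Lemma ellD W T U : submod W -> submod T -> submod U -> W `<=` T -> T `<=` U ->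
  finlen W U -> ell W U = (ell W T + ell T U)%N.
Proof.
move=> sW sT sU WT TU f.
have [c1 m1] := ellP sW (subset_trans WT TU) f.
have [c2 m2] := ellP sW WT (finlen_mono (@subset_refl _ W) TU f).
have [c3 m3] := ellP sT TU (finlen_mono WT (@subset_refl _ U) f).
have := m1 _ (chain_cat c2 c3).
have [i [j [kij /m2 ib /m3 jc]]] := chain_split sW sT sU WT TU c1; lia.
Qed.

Lemma ell_mono W W' U U' : submod W -> submod W' ->
  W `<=` W' -> U' `<=` U -> W' `<=` U' -> finlen W U ->
  (ell W' U' <= ell W U)%N.
Proof.
move=> sW sW' WW UU WU f.
have WU' := subset_trans (subset_trans WW WU) UU.
have [c1 m1] := ellP sW WU' f.
have [c2 m2] := ellP sW' WU (finlen_mono WW UU f).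
by apply: m1; apply: chain_mono c2.
Qed.

Lemma ell_id W : submod W -> ell W W = 0%N.
Proof.
move=> sW; have h k : chain W W k -> k = 0%N.
  case: k => // k [N [sN WN NW sm]]; have [_ []] := sm k (ltnSn _).
  move=> x /NW /WN; apply: (ssub_mono sm) => //; exact: leqnSn.
have [|/h //] := @ellP W W sW (@subset_refl _ W).
by exists 0%N => k /h ->.
Qed.

Lemma ell_gt0 W U : submod W -> submod U -> ssub W U -> finlen W U -> (0 < ell W U)%N.
Proof.
move=> sW sU WU f; have [_ h] := ellP sW WU.1 f.
by apply/h/(chain_snoc _ sU WU)/chain0.
Qed.

End Length.

Section LengthTransfer.
Variables (A : comPzRingType) (V V' : lmodType A) (f : V -> V').
Variables (U : set V) (W' U' : set V').
Hypothesis lf : forall a x y, f (a *: x + y) = a *: f x + f y.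
Hypotheses (sU : submod U) (sW' : submod W').
Hypotheses (fU : forall u, U u -> U' (f u)) (WU' : W' `<=` U').
Hypotheses (UfW : U' `<=` sadd (f @` U) W') (sU' : submod U').

(** The hypotheses say that f induces an isomorphism from U modulo the preimage of W' onto U' / W'.
    Chains move forward by taking images enlarged by W', and back by taking preimages. *)
Lemma chain_transfer k : chain [set u | U u /\ W' (f u)] U k <-> chain W' U' k.
Proof.
have fB x y : f (x - y) = f x - f y.
  by rewrite addrC -scaleN1r lf scaleN1r addrC.
split=> -[N [sN WN NU sm]]; have Nmono := ssub_mono sm.
- exists (fun i => sadd (f @` N i) W'); split.
  + by move=> i; apply: submod_sadd => //; apply: submod_im.
  + by apply: sadd_r; apply: submod_im.
  + by apply: sadd_sub => // _ [u /NU Uu <-]; apply: fU.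
  move=> i ik; have [NN nNN] := sm i ik; split.
    by apply: sadd_mono => // _ [u Nu <-]; exists u => //; apply: NN.
  move=> h; apply: nNN => x Nx.
  have [|_ [w [[y Ny <-] Ww e]]] := h (f x).
    by apply: sadd_l => //; exists x.
  rewrite -[x](subrK y); apply: submodD => //.
  apply: (Nmono 0%N i) => //; first exact: ltnW.
  apply: WN; split; last by rewrite fB e addrC addKr.
  have Uk j z : (j <= k)%N -> N j z -> U z by move=> jk /(Nmono j k jk (leqnn k)) /NU.
  by apply: submodB => //; [exact: Uk Nx|exact: Uk (ltnW ik) Ny].
- exists (fun i => [set u | U u /\ N i (f u)]); split.
  + by move=> i; apply: submod_preim.
  + by move=> u [Uu Wu]; split=> //; apply: WN.
  + by move=> u [].
  move=> i ik; have [NN nNN] := sm i ik; split.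
    by move=> u [Uu Nu]; split=> //; apply: NN.
  move=> h; apply: nNN => x Nx.
  have [|_ [w [[u Uu <-] Ww e]]] := UfW (t := x).
    by apply: NU; apply: (Nmono i.+1 k) => //.
  have Nw j : (j <= k)%N -> N j w by move=> jk; apply: (Nmono 0%N j) => //; apply: WN.
  rewrite e; apply: submodD => //; last exact/Nw/ltnW.
  have [] // : [set u | U u /\ N i (f u)] u; apply: h; split=> //.
  by apply: (@submodDl _ _ _ _ w) => //; [apply: Nw|rewrite -e].
Qed.

Lemma ell_transfer : ell [set u | U u /\ W' (f u)] U = ell W' U'.
Proof.
rewrite /ell; congr natmax; apply/seteqP; split=> k /=;
  by case: (chain_transfer k).
Qed.

Lemma finlen_transfer : finlen [set u | U u /\ W' (f u)] U <-> finlen W' U'.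
Proof. by split=> -[b hb]; exists b => k /chain_transfer; apply: hb. Qed.

End LengthTransfer.

Section Colon.
Variables (A : comPzRingType) (V : lmodType A).
Implicit Types (W U : set V) (v : V).

Lemma submod_colon W v : submod W -> submod (colon W v).
Proof.
move=> sW; split; first by rewrite /colon /= scale0r; apply: submod0.
move=> a x y Wx Wy; rewrite /colon /= scalerDl -[a *: x]/(a * x) -scalerA.
exact: sW.2.
Qed.

(** Multiplication by v identifies A / (W : v) with (W + A v) / W. *)
Lemma line_transfer W v : submod W ->
  (finlen (colon W v) setT <-> finlen W (sadd W (line v))) /\
  ell (colon W v) setT = ell W (sadd W (line v)).
Proof.
move=> sW; have e : colon W v = [set a : A^o | setT a /\ W ((a : A) *: v)].
  by apply/seteqP; split=> [a|a []].
have lf (a : A) (x y : A^o) :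
    ((a *: x + y : A^o) : A) *: v = a *: ((x : A) *: v) + (y : A) *: v.
  by rewrite scalerDl -[a *: x]/(a * x) -scalerA.
have sl := submod_line v.
have h1 (u : A^o) : setT u -> sadd W (line v) ((u : A) *: v).
  by move=> _; apply: sadd_r => //; exists u.
have h2 : sadd W (line v) `<=` sadd ((fun u : A^o => (u : A) *: v) @` setT) W.
  rewrite saddC; apply: sadd_mono => // _ [a ->]; by exists a.
split; rewrite e.
  apply: (finlen_transfer lf _ sW h1 _ h2 (submod_sadd sW sl)) => //.
  exact: sadd_l.
apply: (ell_transfer lf _ sW h1 _ h2 (submod_sadd sW sl)) => //.
exact: sadd_l.
Qed.

End Colon.

(** * Noetherian modules and prime filtrations *)

Lemma inc_mono (T : Type) (N : nat -> set T) : (forall i, N i `<=` N i.+1) ->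
  forall i l, (i <= l)%N -> N i `<=` N l.
Proof.
move=> inc i; elim=> [|l IH]; first by rewrite leqn0 => /eqP ->.
by rewrite leq_eqVlt => /orP[/eqP -> //|/IH h x /h /inc].
Qed.

Lemma submod_bigcup (A : comPzRingType) (V : lmodType A) (N : nat -> set V) :
  (forall i, submod (N i)) -> (forall i, N i `<=` N i.+1) -> submod (\bigcup_i N i).
Proof.
move=> sN /inc_mono mono; split; first by exists 0%N => //; apply: submod0.
move=> a x z [i _ Nx] [j _ Nz]; exists (maxn i j) => //; apply: (sN _).2.
  exact: (mono i _ (leq_maxl _ _)).
exact: (mono j _ (leq_maxr _ _)).
Qed.

Section Noetherian.
Variables (A : comPzRingType) (V : lmodType A).
Implicit Types (U W T : set V) (v : V).

(** The maximal condition is the form that yields maximal colon ideals and maximal counterexamples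
    at once; [noetherian_noeth] obtains it from finite generation of ideals. *)
Definition noeth U := forall F : set (set V), F !=set0 ->
  (forall W, F W -> submod W /\ W `<=` U) ->
  exists W, F W /\ forall W', F W' -> W `<=` W' -> W' `<=` W.

Lemma noeth_asc U (N : nat -> set V) : noeth U ->
  (forall i, submod (N i) /\ N i `<=` U) -> (forall i, N i `<=` N i.+1) ->
  exists k, forall j, N j `<=` N k.
Proof.
move=> nU sN inc; have [|W [k _ <-]|W [[k _ <-] hk]] := nU (range N).
- by exists (N 0%N), 0%N.
- exact: sN.
exists k => j; have mono := inc_mono inc.
apply: subset_trans (mono j (maxn j k) (leq_maxl _ _)) _.
by apply: hk; [exists (maxn j k)|apply: mono; exact: leq_maxr].
Qed.

Lemma noeth_zero : noeth [set 0].
Proof.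
move=> F [W FW] hF; exists W; split=> // W' FW' _ x W'x.
have -> : x = 0 by exact: (hF _ FW').2.
by apply: submod0; case: (hF _ FW).
Qed.

End Noetherian.

Section NoetherianModules.
Variables (A : comPzRingType) (V : lmodType A).
Implicit Types (U W T : set V) (v : V).

(** Maximality is reached in two stages. The ideal (W + T : v) measures W modulo T, and W :&: T
    measures the rest; a member of F above W2 that agrees with W2 in both measures equals W2. *)
Lemma noeth_add_line T v : submod T -> noeth T -> noeth (setT : set A^o) ->
  noeth (sadd T (line v)).
Proof.
move=> sT nT nA F [W0 FW0] hF.
have [||_ [[W1 FW1 <-] m1]] := nA [set colon (sadd W T) v | W in F].
- by exists (colon (sadd W0 T) v), W0.
- by move=> _ [W FW <-]; split=> //; apply/submod_colon/submod_sadd => //; case: (hF _ FW).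
have [||_ [[W2 [FW2 e2] <-] m2]] := nT
  [set W `&` T | W in [set W | F W /\ colon (sadd W1 T) v `<=` colon (sadd W T) v]].
- by exists (W1 `&` T); exists W1 => //; split.
- move=> _ [W [FW _] <-]; split; last by move=> x [].
  by apply: submodI => //; case: (hF _ FW).
have [sW2 W2T] := hF _ FW2.
exists W2; split=> // W FW W2W x Wx; have [sW WT] := hF _ FW.
have cW : colon (sadd W2 T) v `<=` colon (sadd W T) v.
  by move=> a; apply: sadd_mono.
have := WT x Wx => -[t [_ [Tt [a ->] e]]].
have : colon (sadd W2 T) v a.
  apply/e2/(m1 (colon (sadd W T) v)); [by exists W|exact: subset_trans e2 cW|].
  exists x, (- t); split=> //; first exact: submodN.
  by rewrite e addrC addKr.
move=> [w [t' [W2w Tt' e']]].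
have TW : W `&` T `<=` W2 `&` T.
  apply: m2; last exact: setSI.
  by exists W => //; split=> //; exact: subset_trans e2 cW.
rewrite -[x](subrK w); apply: submodD => //.
have [] // : (W2 `&` T) (x - w); apply: TW; split; first by apply: submodB => //; exact: W2W.
by rewrite e e' [w + t']addrC addrA addrK; apply: submodD.
Qed.

Fixpoint lspan (vs : seq V) : set V :=
  if vs is v :: vs' then sadd (lspan vs') (line v) else [set 0].

Lemma submod_lspan vs : submod (lspan vs).
Proof.
elim: vs => [|v vs IH] /=; first exact: submod_zero.
by apply: submod_sadd => //; apply: submod_line.
Qed.

Lemma lspan_mem vs v : v \in vs -> lspan vs v.
Proof.
elim: vs => // w vs IH; rewrite inE => /orP[/eqP ->|/IH h] /=.
  by apply: sadd_r; [apply: submod_lspan|apply: line_id].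
by apply: sadd_l => //; apply: submod_line.
Qed.

Lemma lspan_sub vs U : submod U -> (forall v, v \in vs -> U v) -> lspan vs `<=` U.
Proof.
move=> sU; elim: vs => [|v vs IH] h /=; first by move=> _ ->; apply: submod0.
apply: sadd_sub => //; first by apply: IH => w wv; apply: h; rewrite inE wv orbT.
by apply: sub_line => //; apply: h; rewrite mem_head.
Qed.

Lemma spanm_lspan vs : [set x | x \in spanm [set y | y \in vs]] = lspan vs.
Proof.
apply/seteqP; split; first by apply: spanm_sub; [exact: submod_lspan|move=> v; exact: lspan_mem].
apply: lspan_sub; first exact: submod_mem.
by move=> v vvs; apply: mem_spanm.
Qed.

Lemma noeth_lspan vs : noeth (setT : set A^o) -> noeth (lspan vs).
Proof.
move=> nA; elim: vs => [|v vs IH] /=; first exact: noeth_zero.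
by apply: noeth_add_line => //; apply: submod_lspan.
Qed.

Lemma generatesP vs : generates vs -> lspan vs = setT.
Proof.
move=> h; apply/seteqP; split=> // x _; rewrite -spanm_lspan; exact: h.
Qed.

End NoetherianModules.

(** Without a maximal member, choice gives a strictly increasing sequence in F. Its union is
    generated by finitely many elements, which all lie in a single term. *)
Lemma noetherian_noeth (A : comPzRingType) : noetherian A -> noeth (setT : set A^o).
Proof.
move=> nA F [W0 FW0] hF; apply: contrapT => nmax.
have step (W : {W | F W}) : exists W' : {W | F W}, ssub (sval W) (sval W').
  case: W => W FW /=; apply: contrapT => h; apply: nmax; exists W; split=> //.
  move=> W' FW' WW'; apply: contrapT => h'; apply: h.
  by exists (exist _ W' FW').
have [f hf] := choice step.
pose N i : set A^o  := sval (iter i f (exist _ W0 FW0)).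
have sN i : submod (N i) by rewrite /N; case: (iter _ _ _) => W /= FW; case: (hF _ FW).
have inc i : ssub (N i) (N i.+1) by apply: hf.
have mono := inc_mono (fun i => (inc i).1).
pose U : set A^o := \bigcup_i N i.
have sU : submod U by apply: submod_bigcup => // i; case: (inc i).
have [s hs] := nA (spanm U).
have US x : U x <-> x \in spanm [set y | y \in s].
  by rewrite -hs -[X in X <-> _](propext (_ : [set x | x \in spanm U] x <-> U x)) // mem_spanmP.
have [k hk] : exists k, forall x, x \in s -> N k x.
  have : forall x, x \in s -> U x by move=> x xs; apply/US; apply: mem_spanm.
  elim: s {hs US} => [|x s IH] h; first by exists 0%N.
  have [|k hk] := IH; first by move=> y ys; apply: h; rewrite inE ys orbT.
  have [i _ Nx] := h x (mem_head _ _); exists (maxn i k) => y.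
  rewrite inE => /orP[/eqP ->|/hk]; first exact: (mono i _ (leq_maxl _ _)).
  by apply: mono; exact: leq_maxr.
have [_ []] := inc k; move=> x Nx.
have /US : U x by exists k.+1.
by move/(@spanm_sub _ _ _ (N k) (sN k) hk x).
Qed.

(* For I = (xs), [gsum xs U] is I U and [gpow xs U n] is I^n U. *)
Section Gsum.
Variables (A : comPzRingType) (V : lmodType A).
Implicit Types (U W T : set V) (xs : seq A).

Definition scale_set (a : A) U : set V := [set a *: u | u in U].

Fixpoint gsum xs U : set V :=
  if xs is x :: xs' then sadd (scale_set x U) (gsum xs' U) else [set 0].

Definition gpow xs U n := iter n (gsum xs) U.

Lemma submod_scale_set a U : submod U -> submod (scale_set a U).
Proof. by move=> sU; apply: submod_im => // b x y; rewrite scalerDr !scalerA mulrC. Qed.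

Lemma scale_set_sub a U T : (forall u, U u -> T (a *: u)) -> scale_set a U `<=` T.
Proof. by move=> h _ [u /h Tu <-]. Qed.

Lemma submod_gsum xs U : submod U -> submod (gsum xs U).
Proof.
move=> sU; elim: xs => [|x xs IH] /=; first exact: submod_zero.
by apply: submod_sadd => //; apply: submod_scale_set.
Qed.

Lemma gsum_mem xs U x u : submod U -> x \in xs -> U u -> gsum xs U (x *: u).
Proof.
move=> sU; elim: xs => // y xs IH; rewrite inE => /orP[/eqP ->|xxs] Uu /=.
  by apply: sadd_l; [exact: submod_gsum|exists u].
by apply: sadd_r; [exact: submod_scale_set|exact: IH].
Qed.

Lemma gsum_sub xs U T : submod T ->
  (forall x u, x \in xs -> U u -> T (x *: u)) -> gsum xs U `<=` T.
Proof.
move=> sT; elim: xs => [|y xs IH] h /=; first by move=> _ ->; apply: submod0.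
apply: sadd_sub => //; first by apply: scale_set_sub => u; apply: h; rewrite mem_head.
by apply: IH => x u xxs; apply: h; rewrite inE xxs orbT.
Qed.

Lemma gsum_mono xs U W : U `<=` W -> gsum xs U `<=` gsum xs W.
Proof.
move=> UW; elim: xs => [|y xs IH] //=.
by apply: sadd_mono => // _ [u /UW Wu <-]; exists u.
Qed.

Lemma gsum_id xs U : submod U -> gsum xs U `<=` U.
Proof. by move=> sU; apply: gsum_sub => // x u _; apply: submodZ. Qed.

Lemma gsum_sadd xs U W : submod U -> submod W ->
  gsum xs (sadd U W) `<=` sadd (gsum xs U) (gsum xs W).
Proof.
move=> sU sW; apply: gsum_sub.
  by apply: submod_sadd; apply: submod_gsum.
move=> x _ xxs [u [w [Uu Ww ->]]]; exists (x *: u), (x *: w).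
by rewrite scalerDr; split=> //; apply: gsum_mem.
Qed.

Lemma submod_gpow xs U n : submod U -> submod (gpow xs U n).
Proof. by move=> sU; elim: n => // n; exact: submod_gsum. Qed.

Lemma gpow_mono xs U W n : U `<=` W -> gpow xs U n `<=` gpow xs W n.
Proof. by move=> UW; elim: n => // n IH; exact: gsum_mono. Qed.

Lemma gpowS_sub xs U n : submod U -> gpow xs U n.+1 `<=` gpow xs U n.
Proof. by move=> sU; apply: gsum_id; exact: submod_gpow. Qed.

Lemma gpow_le xs U n k : submod U -> (n <= k)%N -> gpow xs U k `<=` gpow xs U n.
Proof.
move=> sU; elim: k => [|k IH]; first by rewrite leqn0 => /eqP ->.
rewrite leq_eqVlt => /orP[/eqP -> //|/IH]; apply: subset_trans; exact: gpowS_sub.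
Qed.

End Gsum.

Section GsumLinear.
Variables (A : comPzRingType) (V V' : lmodType A) (f : V -> V').
Hypothesis lf : forall a x y, f (a *: x + y) = a *: f x + f y.

Lemma gsum_im xs (U : set V) : submod U -> f @` gsum xs U = gsum xs (f @` U).
Proof.
move=> sU; have fD x y : f (x + y) = f x + f y by rewrite -[x]scale1r lf !scale1r.
have fZ a x : f (a *: x) = a *: f x by rewrite -[a *: x]addr0 lf (lin0 lf) addr0.
elim: xs => [|x xs IH] /=; first by rewrite image_set1 (lin0 lf).
rewrite -IH; apply/seteqP; split.
  move=> _ [_ [_ [w [[u Uu <-] Ww ->]]] <-]; exists (x *: f u), (f w).
  by rewrite fD fZ; split=> //; exists (f u) => //; exists u.
move=> _ [_ [_ [[_ [u Uu <-] <-] [w Ww <-] ->]]].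
exists (x *: u + w); last by rewrite fD fZ.
by exists (x *: u), w; split=> //; exists u.
Qed.

Lemma gpow_im xs (U : set V) n : submod U -> f @` gpow xs U n = gpow xs (f @` U) n.
Proof.
move=> sU; elim: n => // n IH.
by rewrite /gpow !iterS gsum_im ?[X in gsum _ X]IH //; exact: submod_gpow.
Qed.

End GsumLinear.

Section Primes.
Variables (A : comPzRingType).
Implicit Types (P Q : set A^o).

Definition primeI P := [/\ submod P, ~ P 1 & forall a b : A, P (a * b) -> P a \/ P b].

Lemma primeI_sub P : primeI P -> submod P. Proof. by case. Qed.

Lemma primeI_exp P (a : A) n : primeI P -> P (a ^+ n) -> P a.
Proof.
case=> _ P1 PM; elim: n => [|n IH]; first by rewrite expr0.
by rewrite exprS => /PM[].
Qed.

Lemma idealZ P (a b : A) : submod P -> P b -> P (a * b).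
Proof. exact: submodZ. Qed.

Variables (V : lmodType A).
Implicit Types (W U : set V) (v : V).

(** The classical argument that maximal annihilators are prime, made relative to a prime Q:
    maximality is only among colon ideals contained in Q. Q is the maximal ideal when filtrations
    are built, and a minimal prime when it is shown to be associated. *)
Lemma colon_prime W v0 Q : noeth (setT : set A^o) -> submod W -> primeI Q ->
  colon W v0 `<=` Q ->
  exists v, [/\ primeI (colon W v), colon W v `<=` Q & colon W v0 `<=` colon W v].
Proof.
move=> nA sW [sQ Q1 QM] h0.
pose F := [set P | exists v, [/\ P = colon W v, P `<=` Q & colon W v0 `<=` P]].
have [||_ [[v [-> vQ v0v]] mx]] := nA F.
- by exists (colon W v0), v0; split.
- by move=> _ [v [-> _ _]]; split=> //; apply: submod_colon.
have sC := submod_colon v sW; exists v; split=> //; split=> //; first by move/vQ.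
have cM c : colon W v `<=` colon W (c *: v).
  by move=> a; rewrite /colon /= scalerA mulrC -scalerA; exact: submodZ.
have mx' c : colon W (c *: v) `<=` Q -> colon W (c *: v) `<=` colon W v.
  move=> cQ; apply: mx => //; exists (c *: v); split=> //.
  exact: subset_trans v0v (cM c).
move=> a b Pab; have [Pb|nPb] := pselect (colon W v b); [by right|left].
have [/mx' h|nQ] := pselect (colon W (b *: v) `<=` Q).
  by apply: h; rewrite /colon /= scalerA.
(* If s b v lies in W and s is outside Q, then (W : s v) stays inside Q because Q is prime. By
   maximality it is contained in (W : v), yet it contains b. *)
exfalso; apply: nQ => s Ws; apply: contrapT => nQs; apply: nPb.
apply: (mx' s); last by move: Ws; rewrite /colon /= !scalerA mulrC.
move=> t; rewrite /colon /= scalerA => /vQ /QM[//|//].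
Qed.

(* Prime filtrations of V / W, given by the successive generators; the factors are
   A / Q for Q in [fprimes W vs]. *)
Fixpoint filt W (vs : seq V) : Prop :=
  if vs is v :: vs' then primeI (colon W v) /\ filt (sadd W (line v)) vs'
  else W = setT.

Fixpoint fprimes W (vs : seq V) : seq (set A^o) :=
  if vs is v :: vs' then colon W v :: fprimes (sadd W (line v)) vs' else [::].

Lemma fprimes_prime W vs Q : filt W vs -> Q \in fprimes W vs -> primeI Q.
Proof.
elim: vs W => //= v vs IH W [pv fv]; rewrite inE => /orP[/eqP -> //|]; exact: IH.
Qed.

Lemma fprimes_ann W vs Q (a : A) : submod W -> Q \in fprimes W vs ->
  (forall v, W (a *: v)) -> Q a.
Proof.
elim: vs W => //= v vs IH W sW; rewrite inE => /orP[/eqP -> //|QW Wa]; first by apply.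
have sl := submod_line v.
by apply: (IH (sadd W (line v))) => // [|u]; [exact: submod_sadd|exact: sadd_l].
Qed.

(** Otherwise each factor prime has an element outside P. Their product is outside P too, but it
    carries V into W. *)
Lemma filt_cover W vs P : submod W -> filt W vs -> primeI P ->
  (forall a : A, (forall v, W (a *: v)) -> P a) ->
  exists2 Q, Q \in fprimes W vs & Q `<=` P.
Proof.
move=> sW fW [sP P1 PM] hP; apply: contrapT => h.
suff [q [nPq Wq]] : exists q : A, ~ P q /\ forall v, W (q *: v) by apply/nPq/hP.
have {}h Q : Q \in fprimes W vs -> exists2 q, Q q & ~ P q.
  move=> QW; apply: contrapT => h'; apply: h; exists Q => // q Qq.
  by apply: contrapT => nPq; apply: h'; exists q.
elim: vs W sW fW {hP} h => /= [|v vs IH] W sW => [->|[pv fv]] h; first by exists 1.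
have [|q [nPq Wq]] := IH _ (submod_sadd sW (submod_line v)) fv.
  by move=> Q QW; apply: h; rewrite inE QW orbT.
have [r Wr nPr] := h _ (mem_head _ _).
exists (r * q); split; first by move/PM => [].
move=> u; have [w [_ [Ww [a ->] e]]] := Wq u.
rewrite -scalerA e scalerDr scalerA mulrC -scalerA.
by apply: submodD => //; apply: submodZ.
Qed.

Lemma finlen_filt W vs : submod W -> filt W vs ->
  (forall Q, Q \in fprimes W vs -> finlen Q setT) -> finlen W setT.
Proof.
elim: vs W => /= [|v vs IH] W sW => [-> _|[pv fv] h].
  by exists 0%N => -[//|k] [N [sN WN NW sm]]; case: (sm k (ltnSn _)) => _ [] x _; apply: (ssub_mono sm (leq0n k)) => //; apply: WN.
have sl := submod_line v; have sWl := submod_sadd sW sl.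
apply: (@finlen_trans _ _ _ (sadd W (line v))) => //; first exact: sadd_l.
  by apply/(line_transfer v sW).1/h; rewrite mem_head.
by apply: IH => // Q QW; apply: h; rewrite inE QW orbT.
Qed.

End Primes.

Section Local.
Variables (A : comPzRingType) (m : set A^o).

Definition local_at := primeI m /\ forall a : A, ~ m a -> exists b, b * a = 1.

Hypotheses (nA : noeth (setT : set A^o)) (lm : local_at).

Lemma proper_sub_max (P : set A^o) : submod P -> ~ P 1 -> P `<=` m.
Proof.
move=> sP P1 a Pa; apply: contrapT => /lm.2[b ba]; apply: P1.
by rewrite -ba; apply: idealZ.
Qed.

Lemma finlen_max : finlen m setT.
Proof.
exists 1%N => -[//|[//|k]] [N [sN mN _ sm]]; exfalso.
have [h01 h10] := sm 0%N isT; have [h12 h21] := sm 1%N isT.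
apply: h10 => a N1a; apply: contrapT => nN0a.
have /lm.2[b ba] : ~ m a by move/mN.
apply: h21 => c _; rewrite -[c]mulr1 -ba mulrA; exact: (idealZ _ (sN 1%N) N1a).
Qed.

Variables (V : lmodType A).

(** A maximal U without a filtration is proper, so some prime (U : v) exists; a filtration starting
    at U + A v would then extend to one starting at U. *)
Lemma ex_filt (W : set V) : noeth (setT : set V) -> submod W -> exists vs, filt W vs.
Proof.
move=> nV; have [pm um] := lm => sW; apply: contrapT => nW.
have [|U [sU _]|U [[sU nU] mx]] := nV [set U | submod U /\ ~ exists vs, filt U vs].
- by exists W.
- by [].
have [v0 nv0] : exists v, ~ U v.
  apply: contrapT => h; apply: nU; exists [::]; apply/seteqP; split=> // v _.
  by apply: contrapT => nUv; apply: h; exists v.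
have [|v [pv _ _]] := colon_prime (v0 := v0) nA sU pm.
  apply: proper_sub_max; first exact: submod_colon.
  by rewrite /colon /= scale1r.
apply: nU; apply: contrapT => nU.
have sl := submod_line v.
have [_ /(_ _)] := pv; rewrite {1}/colon /= scale1r => nv _; apply: nv.
apply: (mx (sadd U (line v))); last by apply: sadd_r => //; apply: line_id.
  split; first exact: submod_sadd.
  by move=> [vs fvs]; apply: nU; exists (v :: vs).
exact: sadd_l.
Qed.

End Local.

(** * Hilbert's basis theorem and the Artin-Rees lemma *)

Section GradedFamilies.
Variables (A : comPzRingType) (V : lmodType A).
Implicit Types (xs : seq A) (y : A) (U W : nat -> set V).

(* A family U stands for the graded module with components U n, and a pair of families
   for the quotients U n / W n; the operators xs have degree 1. *)
Definition gfam xs U := (forall n, submod (U n)) /\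
  forall n x u, x \in xs -> U n u -> U n.+1 (x *: u).

Definition fsub W U := forall n, W n `<=` U n.

Definition evgen xs W U := exists n0, forall n, (n0 <= n)%N ->
  U n.+1 `<=` sadd (W n.+1) (gsum xs (U n)).

Definition noethpair xs W U := forall U', gfam xs U' -> fsub W U' -> fsub U' U ->
  evgen xs W U'.

Definition qfam y W U n : set V :=
  if n is n'.+1 then sadd (W n) (scale_set y (U n')) else W n.

Lemma gfam_behead y xs U : gfam (y :: xs) U -> gfam xs U.
Proof. by move=> [sU h]; split=> // n x u xxs; apply: h; rewrite inE xxs orbT. Qed.

Lemma gfam_qfam y xs W U : gfam xs U -> gfam xs W -> gfam xs (qfam y W U).
Proof.
move=> [sU hU] [sW hW]; split.
  by case=> [|n] //=; apply: submod_sadd => //; apply: submod_scale_set.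
case=> [|n] x u xxs /=.
  by move=> Wu; apply: sadd_l; [apply: submod_scale_set|apply: hW].
move=> [w [_ [Ww [u' Uu <-] ->]]]; exists (x *: w), (y *: (x *: u')).
split; first exact: hW.
  by exists (x *: u') => //; apply: hU.
by rewrite scalerDr !scalerA [y * x]mulrC.
Qed.

Lemma fsub_qfam y W U : (forall n, submod (U n)) -> fsub W (qfam y W U).
Proof. by move=> sU [|n] //=; apply: sadd_l; apply: submod_scale_set. Qed.

Lemma qfam_fsub y xs W U : gfam (y :: xs) U -> fsub W U -> fsub (qfam y W U) U.
Proof.
move=> [sU hU] WU [|n] /=; first exact: WU.
by apply: sadd_sub => //; apply: scale_set_sub => u; apply: hU; rewrite mem_head.
Qed.

(* Hilbert's basis theorem in graded form. Modulo y, the family U is generated by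
   xs; a subfamily U' is controlled by the images mod y of the families
   D k = (U' : y^k), which increase with k and hence stabilize. *)
Lemma evgen_noethpair xs W U : noeth (setT : set V) ->
  gfam xs U -> gfam xs W -> fsub W U -> evgen xs W U -> noethpair xs W U.
Proof.
move=> nV; elim: xs W U => [|y xs IH] W U gU gW WU [n0 gen] U' gU' WU' UU'.
  (* With no operators [gsum] is zero, so U, and with it U', lies in W in large degrees. *)
  exists n0 => n /gen h; exact: subset_trans (UU' _) h.
pose Wp := qfam y W U.
have gWp : gfam xs Wp by apply: gfam_qfam; apply: gfam_behead; eassumption.
have WpU : fsub Wp U by apply: qfam_fsub gU WU.
have WWp : fsub W Wp by apply: fsub_qfam; case: gU.
have [sU hU] := gU; have [sW hW] := gW; have [sU' hU'] := gU'; have [sWp hWp] := gWp.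
have nE : noethpair xs Wp U.
  apply: IH => //; first exact: gfam_behead gU.
  exists n0 => n /gen h u /h [w [_ [Ww [u1 [u2 [Uu1 Uu2 ->]]] ->]]].
  by rewrite addrA; exists (w + u1), u2; split=> //; exists w, u1.
pose D k n := [set u | U n u /\ U' (n + k)%N (y ^+ k *: u)].
have sD k n : submod (D k n).
  by apply: submod_preim => // a u v; rewrite scalerDr !scalerA mulrC.
have incD k n : D k n `<=` D k.+1 n.
  move=> u [Uu U'u]; split=> //; rewrite addnS exprS -scalerA.
  by apply: hU' => //; rewrite mem_head.
have hD k n x u : x \in y :: xs -> D k n u -> D k n.+1 (x *: u).
  move=> xxs [Uu U'u]; split; first exact: hU.
  by rewrite scalerA mulrC -scalerA addSn; apply: hU'.
pose E k n := sadd (D k n) (Wp n).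
have sE k n : submod (E k n) by apply: submod_sadd.
have incE k n : E k n `<=` E k.+1 n by apply: sadd_mono.
have monoE k l n : (k <= l)%N -> E k n `<=` E l n.
  exact: (@inc_mono _ (E^~ n) (incE^~ n)).
have EU k : fsub (E k) U by move=> n; apply: sadd_sub => // u [].
have gE k : gfam xs (E k).
  split=> // n x _ xxs [u [w [Du Ww ->]]]; rewrite scalerDr.
  exists (x *: u), (x *: w); split=> //; last exact: hWp.
  by apply: hD => //; rewrite inE xxs orbT.
have WpE k : fsub Wp (E k) by move=> n; apply: sadd_r.
pose F n := \bigcup_k E k n.
have [n1 gF] : evgen xs Wp F.
  apply: nE; last by move=> n u [k _ /EU].
    split; first by move=> n; apply: submod_bigcup.
    by move=> n x u xxs [k _ Eu]; exists k => //; apply: (gE k).2.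
  by move=> n u Wu; exists 0%N => //; apply: WpE.
(* Up to n1 there are finitely many degrees, and in each of them the E k stabilize because V is
   Noetherian. [FE] carries this to the higher degrees, where F is generated by xs modulo Wp. *)
have [k0 hk0] : exists k0, forall n, (n <= n1)%N -> forall k, E k n `<=` E k0 n.
  elim: n1 {gF} => [|n1 [k1 hk1]].
    have [|//|k hk] := @noeth_asc _ _ setT (fun k => E k 0%N) nV; first by split.
    by exists k => n; rewrite leqn0 => /eqP -> j; apply: hk.
  have [|//|k hk] := @noeth_asc _ _ setT (fun k => E k n1.+1) nV; first by split.
  exists (maxn k k1) => n; rewrite leq_eqVlt => /orP[/eqP ->|nn1] j u Eu.
    by apply: (monoE k); [exact: leq_maxl|exact: hk Eu].
  by apply: (monoE k1); [exact: leq_maxr|exact: hk1 Eu].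
have FE n : F n `<=` E k0 n.
  elim: n => [|n IHn]; first by move=> u [k _]; apply: hk0.
  have [nn1|n1n] := leqP n.+1 n1; first by move=> u [k _]; apply: hk0.
  apply: subset_trans (gF n _) _ => //.
  apply: sadd_sub => //; first exact: WpE.
  apply: gsum_sub => // x u xxs /IHn; exact: (gE k0).2.
have [d hd] : exists d, forall k, (k <= k0)%N -> forall n, (d <= n)%N ->
    E k n.+1 `<=` sadd (Wp n.+1) (gsum xs (E k n)).
  elim: k0 {hk0 FE} => [|k0 [d hd]].
    have [|||d hd] := nE (E 0%N) => //.
    by exists d => k; rewrite leqn0 => /eqP -> n; apply: hd.
  have [|||d' hd'] := nE (E k0.+1) => //; exists (maxn d d') => k.
  rewrite leq_eqVlt => /orP[/eqP ->|kk0] n; rewrite geq_max => /andP[dn d'n].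
    exact: hd'.
  exact: hd.
(* When (j + 1) + k = n + 1 and k <= k0, this bound gives d <= j, the range in which [hd]
   applies. *)
exists (d + k0)%N => n hn.
set G := sadd _ _.
have sG : submod G by apply: submod_sadd => //; exact: submod_gsum.
have GW : W n.+1 `<=` G by apply: sadd_l; apply: submod_gsum.
have GU x u : x \in y :: xs -> U' n u -> G (x *: u).
  by move=> xxs Uu; apply: sadd_r => //; apply: gsum_mem.
have Wy k j w : (j + k = n.+1)%N -> W j w -> G (y ^+ k *: w).
  move=> jk Ww; apply: GW; rewrite -jk.
  elim: k {jk} => [|k IHk]; first by rewrite addn0 expr0 scale1r.
  by rewrite addnS exprS -scalerA; apply: hW => //; rewrite mem_head.
(* Induction on j with the total degree fixed: a remainder y u0 is handled by lowering the degree of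
   u and raising the power of y. The case k = 0 is the claim. *)
suff main j k : (j + k = n.+1)%N -> D k j `<=` [set u | G (y ^+ k *: u)].
  move=> u U'u; have := @main n.+1 0%N; rewrite addn0 => /(_ erefl u).
  by rewrite /= expr0 scale1r; apply; split; [exact: UU'|rewrite addn0 expr0 scale1r].
elim: j k => [|j IHj] k jk u Du; rewrite /=.
  have Ek : E k 0%N u by apply: sadd_l.
  have [//|q [w [[Uq U'q] Ww e]]] := FE 0%N u; first by exists k.
  have : E k.-1 0%N u by apply: (monoE k0); [lia|apply: FE; exists k].
  move=> [q' [w' [[Uq' U'q'] Ww' ->]]]; rewrite scalerDr; apply: submodD => //.
    have -> : y ^+ k = y * y ^+ k.-1 by rewrite -exprS; congr (_ ^+ _); lia.
    rewrite -scalerA; apply: GU; first by rewrite mem_head.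
    by have -> : n = (0 + k.-1)%N by lia.
  exact: Wy Ww'.
have step u0 : U j u0 -> U' n.+1 (y ^+ k *: (y *: u0)) -> G (y ^+ k *: (y *: u0)).
  rewrite scalerA -exprSr => Uu0 U'u0; apply: IHj; first by rewrite addnS -addSn.
  by split=> //; rewrite addnS -addSn jk.
have U'Du : U' n.+1 (y ^+ k *: u) by rewrite -jk; case: Du.
suff [g [u0 [Gg Uu0 U'g e]]] : exists g u0, [/\ G g, U j u0, U' n.+1 g &
    y ^+ k *: u = g + y ^+ k *: (y *: u0)].
  rewrite e; apply: submodD => //; apply: step => //.
  by apply: submodDr U'g _ => //; rewrite -e.
have GU' g : G g -> U' n.+1 g.
  apply: sadd_sub => //; apply: gsum_sub => // x v xxs; exact: hU'.
suff [g [u0 [Gg Uu0 e]]] : exists g u0, [/\ G g, U j u0 &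
    y ^+ k *: u = g + y ^+ k *: (y *: u0)].
  by exists g, u0; split=> //; apply: GU'.
have Ek : E k j.+1 u by apply: sadd_l.
(* For k <= k0, u is written through the operators xs applied to E k. For larger k, u already lies
   in E (k - 1), so that one factor y splits off from y^k. *)
have [kk0|k0k] := leqP k k0.
  have dj : (d <= j)%N by lia.
  have [w [z [Ww Ez ->]]] := hd k kk0 j dj u Ek.
  have : sadd (Wp j.+1) (gsum xs (D k j)) (w + z).
    apply: (submodD (submod_sadd (sWp _) (submod_gsum xs (sD k j)))).
      by apply: sadd_l => //; apply: submod_gsum.
    have [z1 [z2 [h1 h2 ->]]] := gsum_sadd (sD k j) (sWp j) Ez.
    apply: (submodD (submod_sadd (sWp _) (submod_gsum xs (sD k j)))).
      exact: sadd_r.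
    apply: sadd_l; first exact: submod_gsum.
    by apply: (gsum_sub (sWp j.+1) _ h2) => x v xxs; apply: hWp.
  move=> [_ [z' [[w' [_ [Ww' [u0 Uu0 <-] ->]]] Dz ->]]].
  exists (y ^+ k *: w' + y ^+ k *: z'), u0; split=> //.
    apply: submodD => //; first exact: Wy Ww'.
    have sP : submod [set v | G (y ^+ k *: v)].
      have := @submod_preim _ _ _ (fun v => y ^+ k *: v) setT G _ _ sG.
      move=> h; have {h} : submod [set u1 | setT u1 /\ G (y ^+ k *: u1)].
        by apply: h => // a v1 v2; rewrite scalerDr !scalerA mulrC.
      by congr submod; apply/seteqP; split=> [v []|v].
    apply: (gsum_sub sP _ Dz) => x v xxs [_ U'v].
    rewrite /= scalerA mulrC -scalerA; apply: GU; first by rewrite inE xxs orbT.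
    by have <- : (j + k)%N = n by lia.
  by rewrite !scalerDr addrAC.
have : E k.-1 j.+1 u by apply: (monoE k0); [lia|apply: FE; exists k].
move=> [q [_ [[Uq U'q] [w [_ [Ww [u0 Uu0 <-] ->]]] ->]]].
exists (y ^+ k *: q + y ^+ k *: w), u0; split=> //; last by rewrite !scalerDr addrA.
apply: submodD => //; last exact: Wy Ww.
have -> : y ^+ k = y * y ^+ k.-1 by rewrite -exprS; congr (_ ^+ _); lia.
rewrite -scalerA; apply: GU; first by rewrite mem_head.
by have <- : (j.+1 + k.-1)%N = n by lia.
Qed.

(* Artin-Rees: the families I^n V and I^n V :&: (W + A v) are compared by the previous lemma. *)
Lemma gpow_colon xs (W : set V) v : noeth (setT : set V) -> submod W ->
  exists c, forall n,
    colon (sadd W (gpow xs setT (n + c))) v `<=`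
    sadd (colon W v) (gpow xs (setT : set A^o) n).
Proof.
move=> nV sW; have sl := submod_line v; set N := sadd W (line v).
have sN : submod N by apply: submod_sadd.
have sp n : submod (gpow xs (setT : set V) n) by apply: submod_gpow.
have [|||||||c hc] := @evgen_noethpair xs (fun=> [set 0]) (gpow xs setT) nV _ _ _ _
    (fun n => gpow xs setT n `&` N).
- by split=> // n x u xxs Uu; apply: gsum_mem.
- split; first by move=> _; exact: submod_zero.
  by move=> n x u _ ->; rewrite scaler0.
- by move=> n _ ->; exact: submod0 (sp n).
- by exists 0%N => n _; apply: sadd_r; exact: submod_zero.
- split; first by move=> n; apply: submodI.
  by move=> n x u xxs [Uu Nu]; split; [apply: gsum_mem|apply: submodZ].
- by move=> n _ ->; split; apply: submod0.
- by move=> n u [].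
(* The usual Artin-Rees inclusion: from degree c on, I^(n+1) V :&: N is contained in I (I^n V :&:
   N). *)
have sub n : gpow xs setT (n + c) `&` N `<=` gpow xs N n.
  elim: n => [|n IH]; first by move=> u [].
  rewrite addSn; apply: subset_trans (hc _ (leq_addl _ _)) _.
  apply: sadd_sub; [exact: submod_gpow|move=> _ ->; apply: submod0; exact: submod_gpow|].
  exact: gsum_mono.
exists c => n a [w [p [Ww Pp e]]].
have Np : N p.
  apply: (@submodDr _ _ _ w) => //; first by apply: sadd_l.
  by rewrite -e; apply: sadd_r => //; exists a.
have {Pp} : sadd (gpow xs W n) (gpow xs (line v) n) p.
  have : gpow xs N n p by apply: sub.
  elim: n p {e Np Pp} => // n IH p; apply: gsum_sub.
    by apply: submod_sadd; apply: submod_gpow.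
  move=> x u xxs /IH [u1 [u2 [h1 h2 ->]]]; exists (x *: u1), (x *: u2).
  by rewrite scalerDr; split=> //; apply: gsum_mem => //; apply: submod_gpow.
move=> [w' [p' [Ww' Pp' ep]]].
have {}Ww' : W w' by exact: (gpow_le sW (leq0n n) Ww').
have lf (b : A) (x z : A^o) :
    ((b *: x + z : A^o) : A) *: v = b *: ((x : A) *: v) + (z : A) *: v.
  by rewrite scalerDl -[b *: x]/(b * x) -scalerA.
have : gpow xs ((fun b : A^o => (b : A) *: v) @` setT) n p'.
  by apply: gpow_mono Pp' => _ [b ->]; exists b.
(* An element of I^n (A v) is b v with b in I^n; subtracting b from a leaves an element of (W :
   v). *)
rewrite -gpow_im // => -[b Pb eb].
exists (a - b), b; rewrite subrK; split=> //.
by rewrite /colon /= scalerBl e ep -eb addrA addrK; apply: submodD.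
Qed.

End GradedFamilies.

(** * Hilbert polynomials *)

Section PolynomialGrowth.
Variable K : realType.
Implicit Types (p q : {poly K}) (f g : nat -> K).

(** Here d bounds the size, so the degree is less than d and d = 0 means eventually zero. In
    [growth], by contrast, d is the exponent itself. *)
Definition evp d f := exists p, (size p <= d)%N /\
  exists n0, forall n, (n0 <= n)%N -> f n = p.[n%:R].

Definition growth d f := exists C n0, forall n, (n0 <= n)%N -> f n <= C * n%:R ^+ d.

Lemma size_polyB_leq p q d : (size p <= d)%N -> (size q <= d)%N -> (size (p - q)%R <= d)%N.
Proof. by move=> hp hq; apply: leq_trans (size_polyD _ _) _; rewrite geq_max hp size_polyN. Qed.

Lemma size_polyD_leq p q d : (size p <= d)%N -> (size q <= d)%N -> (size (p + q)%R <= d)%N.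
Proof. by move=> hp hq; apply: leq_trans (size_polyD _ _) _; rewrite geq_max hp. Qed.

Lemma size_mulXaddC p c d : (size p <= d)%N -> (size (('X + c%:P) * p)%R <= d.+1)%N.
Proof.
move=> hp; apply: leq_trans (size_polyMleq _ _) _; rewrite size_XaddC.
by move: hp; case: (size p).
Qed.

Lemma size_XaddC_exp_sub c i : (size (('X + c%:P) ^+ i - 'X^i : {poly K})%R <= i)%N.
Proof.
elim: i => [|i IH]; first by rewrite !expr0 subrr size_poly0.
have -> : ('X + c%:P) ^+ i.+1 - 'X^(i.+1) =
    ('X + c%:P) * (('X + c%:P) ^+ i - 'X^i) + c *: 'X^i.
  by rewrite -mul_polyC !exprS; ring.
apply: size_polyD_leq; first exact: size_mulXaddC.
by apply: leq_trans (size_scale_leq _ _) _; rewrite size_polyXn.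
Qed.

(** The leading terms of p(X + c) and p cancel. *)
Lemma size_shift_sub p c d : (size p <= d.+1)%N ->
  (size (p \Po ('X + c%:P) - p)%R <= d)%N.
Proof.
move=> hp; rewrite comp_polyE [X in _ - X](_ : p = \sum_(i < size p) p`_i *: 'X^i);
  last by rewrite -poly_def coefK.
rewrite -sumrB; apply: (big_ind (fun r : {poly K} => size r <= d)%N).
- by rewrite size_poly0.
- by move=> x y; apply: size_polyD_leq.
move=> i _; rewrite -scalerBr; apply: leq_trans (size_scale_leq _ _) _.
by apply: leq_trans (size_XaddC_exp_sub _ _) _; rewrite -ltnS (leq_trans _ hp).
Qed.

Lemma size_Xadd1_exp k :
  (size (('X + 1%:P) ^+ k.+1 - 'X^(k.+1) - k.+1%:R *: 'X^k : {poly K})%R <= k)%N.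
Proof.
elim: k => [|k IH].
  rewrite !expr1 expr0 (_ : _ - _ = 0) ?size_poly0 //.
  by rewrite scale1r polyC1; ring.
have -> : ('X + 1%:P) ^+ k.+2 - 'X^(k.+2) - k.+2%:R *: 'X^(k.+1) =
    ('X + 1%:P) * (('X + 1%:P) ^+ k.+1 - 'X^(k.+1) - k.+1%:R *: 'X^k)
    + k.+1%:R *: 'X^k :> {poly K}.
  by rewrite -!mul_polyC !polyC_natr polyC1 !exprS; ring.
apply: size_polyD_leq; first exact: size_mulXaddC.
by apply: leq_trans (size_scale_leq _ _) _; rewrite size_polyXn.
Qed.

Lemma poly_antidifference p d : (size p <= d)%N ->
  exists q, (size q <= d.+1)%N /\ q \Po ('X + 1%:P) - q = p.
Proof.
elim: d p => [|d IH] p hp.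
  exists 0; rewrite size_poly0 comp_poly0 subr0; split=> //.
  by apply/esym/eqP; rewrite -size_poly_leq0.
(* The difference of X^(d+1) has leading term (d+1) X^d, so this c removes the top term of p and
   leaves a polynomial for the induction. *)
pose c := p`_d / d.+1%:R; pose q := c *: 'X^(d.+1).
have [|r [sr er]] := IH (p - (q \Po ('X + 1%:P) - q)).
  have -> : p - (q \Po ('X + 1%:P) - q) = (p - p`_d *: 'X^d)
      - c *: (('X + 1%:P) ^+ d.+1 - 'X^(d.+1) - d.+1%:R *: 'X^d).
    rewrite /q comp_polyZ comp_Xn_poly scalerBr scalerBr scalerA mulfVK ?pnatr_eq0 //.
    by rewrite -!mul_polyC; ring.
  apply: size_polyB_leq; last first.
    exact: leq_trans (size_scale_leq _ _) (size_Xadd1_exp _).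
  apply/leq_sizeP => j; rewrite leq_eqVlt coefB coefZ coefXn => /orP[/eqP <-|dj].
    by rewrite eqxx mulr1 subrr.
  by rewrite gtn_eqF // mulr0 subr0 nth_default // (leq_trans hp).
exists (q + r); split.
  apply: size_polyD_leq; last exact: leq_trans sr _.
  by apply: leq_trans (size_scale_leq _ _) _; rewrite size_polyXn.
by rewrite comp_polyD opprD addrACA er addrC subrK.
Qed.

Lemma evp_eq d f g n0 : (forall n, (n0 <= n)%N -> f n = g n) -> evp d f -> evp d g.
Proof.
move=> fg [p [sp [n1 h]]]; exists p; split=> //; exists (maxn n0 n1) => n.
by rewrite geq_max => /andP[h0 h1]; rewrite -fg // h.
Qed.

Lemma evpD d f g : evp d f -> evp d g -> evp d (fun n => f n + g n).
Proof.
move=> [p [sp [n0 hp]]] [q [sq [n1 hq]]]; exists (p + q); split.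
  exact: size_polyD_leq.
exists (maxn n0 n1) => n; rewrite geq_max => /andP[h0 h1].
by rewrite hp // hq // hornerD.
Qed.

Lemma evpN d f : evp d f -> evp d (fun n => - f n).
Proof.
move=> [p [sp [n0 hp]]]; exists (- p); rewrite size_polyN; split=> //.
by exists n0 => n /hp ->; rewrite hornerN.
Qed.

Lemma evp_shift d c f : evp d f -> evp d (fun n => f (n + c)%N).
Proof.
move=> [p [sp [n0 h]]]; exists (p \Po ('X + (c%:R)%:P)); split.
  rewrite -[_ \Po _](subrK p); apply: size_polyD_leq => //.
  by apply/size_shift_sub/leqW.
exists n0 => n n0n; rewrite h ?(leq_trans n0n) ?leq_addr //.
by rewrite horner_comp hornerD hornerX hornerC natrD.
Qed.

Lemma evp_sum d f : evp d (fun n => f n.+1 - f n) -> evp d.+1 f.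
Proof.
move=> [p [sp [n0 h]]]; have [q [sq eq]] := poly_antidifference sp.
(* The difference determines f up to a constant, which is fixed by the value at n0. *)
exists (q + (f n0 - q.[n0%:R])%:P); split.
  apply: size_polyD_leq => //; apply: leq_trans (size_polyC_leq1 _) _ => //.
exists n0 => n; elim: n => [|n IH].
  by rewrite leqn0 => /eqP ->; rewrite hornerD hornerC addrC subrK.
rewrite leq_eqVlt => /orP[/eqP <-|n0n]; first by rewrite hornerD hornerC addrC subrK.
have e : (q \Po ('X + 1%:P) - q).[n%:R] = q.[n.+1%:R] - q.[n%:R].
  by rewrite hornerD hornerN horner_comp hornerD hornerX hornerC natr1.
have /eqP := h n n0n; rewrite -eq e IH // subr_eq => /eqP ->.
by rewrite !hornerD !hornerC; ring.
Qed.

Lemma horner_growth p d : (size p <= d.+1)%N ->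
  exists C, forall n, (0 < n)%N -> `|p.[n%:R]| <= C * n%:R ^+ d.
Proof.
move=> sp; exists (\sum_(i < size p) `|p`_i|) => n n0.
rewrite horner_coef mulr_suml; apply: le_trans (ler_norm_sum _ _ _) _.
apply: ler_sum => i _; rewrite normrM ler_wpM2l // normrX normr_nat.
by rewrite ler_weXn2l ?ler1n // -ltnS (leq_trans _ sp).
Qed.

Lemma evp_growth d f : evp d.+1 f -> growth d f.
Proof.
move=> [p [/horner_growth[C hC] [n0 h]]]; exists C, (maxn n0 1) => n.
rewrite geq_max => /andP[h0 h1]; rewrite h //.
exact: le_trans (ler_norm _) (hC _ h1).
Qed.

Lemma growth_le d f g : (forall n, f n <= g n) -> growth d g -> growth d f.
Proof.
by move=> fg [C [n0 h]]; exists C, n0 => n /h; apply: le_trans.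
Qed.

Lemma natr_unbounded (x : K) n0 : exists n, (n0 <= n)%N /\ x < n%:R.
Proof.
have [n hn] : exists n : nat, x < n%:R.
  exists (Num.bound `|x|); apply: le_lt_trans (ler_norm _) _; exact: archi_boundP.
exists (maxn n0 n); rewrite leq_maxl; split=> //; apply: lt_le_trans hn _.
by rewrite ler_nat leq_maxr.
Qed.

(** If the degree were k + 1 > d, the top term would outgrow both the bound on f and the lower
    terms, which are O(n^k). The sign condition on f turns the one-sided bound of [growth] into a
    bound on its absolute value. *)
Lemma growth_size d f p n0 : (forall n, 0 <= f n) ->
  (forall n, (n0 <= n)%N -> f n = p.[n%:R]) -> growth d f -> (size p <= d.+1)%N.
Proof.
move=> f0 hp [C [n1 hC]]; rewrite leqNgt; apply/negP => sp.
have [k ek] : exists k, size p = k.+2 by exists (size p).-2; lia.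
pose q := take_poly k.+1 p; pose l := p`_k.+1.
have ep : p = q + l *: 'X^(k.+1).
  rewrite -[LHS](poly_take_drop k.+1) -mul_polyC; congr (_ + _ * _).
  apply/polyP => i; rewrite coef_drop_poly coefC; case: eqP => [->|/eqP i0].
    by rewrite add0n.
  by rewrite nth_default // ek; lia.
have [D hD] : exists D, forall n, (0 < n)%N -> `|q.[n%:R]| <= D * n%:R ^+ k.
  by apply: horner_growth; exact: size_take_poly.
have l0 : 0 < `|l|.
  have : lead_coef p != 0 by rewrite lead_coef_eq0 -size_poly_eq0 ek.
  by rewrite /lead_coef ek /= normr_gt0.
(* Here C bounds f and D bounds q, both in units of n^k, so beyond this n the term l n^(k+1) cannot
   be their difference. *)
have [n []] := natr_unbounded ((`|C| + D) / `|l|) (maxn (maxn n0 n1) 1).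
rewrite !geq_max ltr_pdivrMr // => /andP[/andP[nn0 nn1] n_gt0]; apply/negP.
rewrite -leNgt -(ler_pM2r (exprn_gt0 k (_ : 0 < n%:R))) ?ltr0n //.
have := hD _ n_gt0; have h1 := hC _ nn1; have h0 := f0 n.
rewrite mulrDl mulrAC -exprS => h2.
have h3 : `|f n| <= `|C| * n%:R ^+ k.
  rewrite ger0_norm //; apply: le_trans h1 _.
  apply: le_trans (_ : `|C| * n%:R ^+ d <= _).
    by rewrite ler_wpM2r ?exprn_ge0 // ler_norm.
  by rewrite ler_wpM2l // ler_weXn2l ?ler1n //; lia.
have e : f n = q.[n%:R] + l * n%:R ^+ k.+1.
  by rewrite hp // {1}ep hornerD hornerZ hornerXn.
have -> : n%:R ^+ k.+1 * `|l| = `|f n - q.[n%:R]|.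
  by rewrite e addrC addKr normrM normrX normr_nat mulrC.
apply: le_trans (ler_normB _ _) _; exact: lerD.
Qed.

End PolynomialGrowth.

Section HilbertPolynomial.
Variables (K : realType) (A : comPzRingType) (V : lmodType A).
Implicit Types (xs : seq A) (y : A) (U W : nat -> set V).

(* Induction on the number of operators: the kernel and the cokernel of
   multiplication by y on the quotients U n / W n are again such families. *)
Lemma ell_evp xs W U : gfam xs U -> gfam xs W -> fsub W U ->
  (forall n, finlen (W n) (U n)) -> noethpair xs W U ->
  evp (size xs) (fun n => (ell (W n) (U n))%:R : K).
Proof.
elim: xs W U => [|y xs IH] W U gU gW WU fl np.
  have [n0 h] := np U gU WU (fun n => @subset_refl _ (U n)).
  exists 0; rewrite size_poly0; split=> //; exists n0.+1 => -[//|n] /h /= hn.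
  have [sW _] := gW; rewrite horner0 (_ : U n.+1 = W n.+1) ?ell_id //.
  apply/seteqP; split; last exact: WU.
  apply: subset_trans hn _; apply: sadd_sub => // _ ->; exact: submod0.
have [[sU hU] [sW hW]] := (gU, gW).
have gU' := gfam_behead gU; have gW' := gfam_behead gW.
pose Kr n := [set u | U n u /\ W n.+1 (y *: u)].
have lfy (a : A) (u v : V) : y *: (a *: u + v) = a *: (y *: u) + y *: v.
  by rewrite scalerDr !scalerA mulrC.
have sK n : submod (Kr n) by apply: submod_preim.
have WK : fsub W Kr by move=> n u Wu; split; [exact: WU|apply: hW => //; rewrite mem_head].
have KU : fsub Kr U by move=> n u [].
have gK : gfam xs Kr.
  split=> // n x u xxs [Uu Wu]; split; first by apply: hU => //; rewrite inE xxs orbT.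
  by rewrite scalerA mulrC -scalerA; apply: hW => //; rewrite inE xxs orbT.
pose C := qfam y W U.
have gC : gfam xs C by apply: gfam_qfam.
have WC : fsub W C by apply: fsub_qfam.
have CU : fsub C U by apply: qfam_fsub gU WU.
have evK : evp (size xs) (fun n => (ell (W n) (Kr n))%:R : K).
  apply: IH => // [n|U' gU1 WU1 UK1].
    by apply: finlen_mono (fl n) => //; exact: KU.
  have [||n0 h] := np U' _ WU1.
  - split; first by case: gU1.
    move=> n x u; rewrite inE => /orP[/eqP ->|xxs] Uu; last exact: gU1.2.
    by apply: WU1; case: (UK1 _ _ Uu).
  - by move=> n u /UK1 /KU.
  exists n0 => n /h hn; apply: subset_trans hn _ => /=.
  (* On the kernel y acts as zero modulo W, so its contribution to [gsum] is absorbed and xs alone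
     generate. *)
  have sg := submod_gsum xs (gU1.1 n).
  apply: sadd_sub; [exact: submod_sadd|exact: sadd_l|].
  apply: sadd_sub; [exact: submod_sadd| |exact: sadd_r].
  apply: scale_set_sub => u /UK1 [_ Wu]; exact: sadd_l.
have evC : evp (size xs) (fun n => (ell (C n) (U n))%:R : K).
  apply: IH => // [n|U' gU1 CU1 UU1]; first by apply: finlen_mono (fl n) => //; exact: WC.
  have WU1 n : W n `<=` U' n by move=> u /WC /CU1.
  have yU1 n : scale_set y (U n) `<=` U' n.+1.
    apply: scale_set_sub => u Uu; apply: CU1; apply: sadd_r => //.
    by exists u.
  have [||n0 h] := np U' _ WU1 => //.
    split; first by case: gU1.
    move=> n x u; rewrite inE => /orP[/eqP ->|xxs] Uu; last exact: gU1.2.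
    by apply: yU1; exists u => //; apply: UU1.
  exists n0 => n /h hn; apply: subset_trans hn _.
  have sg := submod_gsum xs (gU1.1 n).
  have sC := gC.1 n.+1.
  apply: sadd_sub; first exact: submod_sadd.
    by move=> u /WC; apply: sadd_l.
  apply: sadd_sub; [exact: submod_sadd| |exact: sadd_r].
  move=> _ [u Uu <-]; apply: sadd_l => //=; apply: sadd_r => //.
  by exists u => //; apply: UU1.
(* In the exact sequence 0 -> Kr n / W n -> U n / W n -> U (n+1) / W (n+1) -> U (n+1) / C (n+1) ->
   0, whose middle map is multiplication by y, the difference of the middle lengths equals the
   difference of the outer ones. *)
apply: evp_sum.
apply: (evp_eq (n0 := 0%N)) (evpD (evp_shift 1 evC) (evpN evK)) => n _.
rewrite addn1.
have -> : ell (W n.+1) (U n.+1) = (ell (W n.+1) (C n.+1) + ell (C n.+1) (U n.+1))%N.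
  exact: (ellD (sW _) (gC.1 _) (sU _) (WC _) (CU _) (fl _)).
have -> : ell (W n) (U n) = (ell (W n) (Kr n) + ell (Kr n) (U n))%N.
  exact: (ellD (sW _) (sK _) (sU _) (WK _) (KU _) (fl _)).
have -> : ell (Kr n) (U n) = ell (W n.+1) (C n.+1).
  apply: (ell_transfer lfy) => //; last exact: gC.1.
  - by move=> u Uu; apply: sadd_r => //; exists u.
  - by rewrite saddC.
by rewrite !natrD; ring.
Qed.

(** The Hilbert-Samuel function of V / W with respect to the ideal (xs). *)
Definition hilb xs (W : set V) n := ell (sadd W (gpow xs setT n)) setT.

Lemma submod_hilb xs (W : set V) n : submod W -> submod (sadd W (gpow xs setT n)).
Proof. by move=> sW; apply: submod_sadd => //; apply: submod_gpow. Qed.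

(** The first difference is the Hilbert function of the associated graded module with components U n
    / U (n+1); summing it costs one in the size. *)
Lemma hilb_evp xs (W : set V) : noeth (setT : set V) -> submod W ->
  (forall n, finlen (sadd W (gpow xs setT n)) setT) ->
  evp (size xs).+1 (fun n => (hilb xs W n)%:R : K).
Proof.
move=> nV sW fl; apply: evp_sum.
pose U n := sadd W (gpow xs setT n).
have sU n : submod (U n) by apply: submod_hilb.
have UU n : U n.+1 `<=` U n by apply: sadd_mono => //; apply: gpowS_sub.
have gU : gfam xs U.
  split=> // n x _ xxs [w [u [Ww Pu ->]]]; exists (x *: w), (x *: u).
  by rewrite scalerDr; split; [exact: submodZ|apply: gsum_mem => //; apply: submod_gpow|].
have gU1 : gfam xs (fun n => U n.+1) by case: gU => _ h; split=> // n; exact: h.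
apply: (evp_eq (n0 := 0%N)) (ell_evp gU gU1 UU _ _) => [n _|n|].
- have -> : hilb xs W n.+1 = (ell (U n.+1) (U n) + hilb xs W n)%N.
    exact: (ellD (sU n.+1) (sU n) (submodT V) (UU n) (@subsetT _ (U n)) (fl n.+1)).
  by rewrite natrD addrK.
- exact: finlen_mono (fl n.+1).
apply: evgen_noethpair => //; exists 0%N => n _; apply: sadd_sub.
- by apply: submod_sadd => //; apply: submod_gsum.
- by move=> w Ww; apply: sadd_l; [apply: submod_gsum|apply: sadd_l => //; exact: (submod_gpow xs n.+2 (submodT V))].
- move=> u Pu; apply: sadd_r => //; apply: gsum_mono Pu; apply: sadd_r => //.
Qed.

End HilbertPolynomial.

(** * Dimension *)

Section PrimeChains.
Variable A : comPzRingType.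
Implicit Types (P Q I : set A^o).

Definition pch I k := exists P : nat -> set A^o,
  [/\ forall i, primeI (P i), I `<=` P 0%N & forall i, (i < k)%N -> ssub (P i) (P i.+1)].

Lemma pch_sub I J k : J `<=` I -> pch I k -> pch J k.
Proof. by move=> JI [P [pP IP sP]]; exists P; split=> //; apply: subset_trans IP. Qed.

Lemma pch0 P : primeI P -> pch P 0.
Proof. by move=> pP; exists (fun=> P); split. Qed.

Lemma pch_cons P Q k : primeI P -> ssub P Q -> pch Q k -> pch P k.+1.
Proof.
move=> pP [PQ nQP] [N [pN QN sN]]; exists (fun i => if i is i'.+1 then N i' else P).
split=> //; first by case.
case=> [_|i]; last exact: sN.
split; first exact: subset_trans QN.
by move=> h; apply: nQP => x /QN /h.
Qed.

Lemma pch_behead I k : pch I k.+1 -> exists P Q, [/\ primeI P, primeI Q, I `<=` P, ssub P Q & pch Q k].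
Proof.
move=> [N [pN IN sN]]; exists (N 0%N), (N 1%N); split=> //; first exact: sN.
by exists (fun i => N i.+1); split=> // i ik; apply: sN.
Qed.

(** A strict inclusion of P in Q would prolong a chain of length t above Q to one of length t + 1
    above I. *)
Lemma pch_max_sub I P Q t : primeI P -> I `<=` P -> P `<=` Q ->
  (forall k, pch I k -> (k <= t)%N) -> pch Q t -> Q `<=` P.
Proof.
move=> pP IP PQ mt hQ; apply: contrapT => nQP.
have /mt := pch_sub IP (pch_cons pP (conj PQ nQP) hQ); by rewrite ltnn.
Qed.

Lemma common_element (Ps : seq (set A^o)) P : primeI P ->
  (forall Q, Q \in Ps -> ~ Q `<=` P /\ submod Q) ->
  exists2 b : A, ~ P b & forall Q, Q \in Ps -> Q b.
Proof.
move=> [sP P1 PM]; elim: Ps => [|Q Ps IH] h; first by exists 1.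
have [|b nPb hb] := IH; first by move=> Q' Q'P; apply: h; rewrite inE Q'P orbT.
have [nQP sQ] := h Q (mem_head _ _).
have [a Qa nPa] : exists2 a : A, Q a & ~ P a.
  apply: contrapT => h'; apply: nQP => a Qa; apply: contrapT => nPa; apply: h'.
  by exists a.
exists (a * b); first by move/PM => [].
move=> Q'; rewrite inE => /orP[/eqP ->|Q'P].
  by rewrite mulrC; apply: idealZ.
apply: idealZ; last exact: hb.
by have [] := h Q'; rewrite // inE Q'P orbT.
Qed.

Lemma prime_avoidance I (Ps : seq (set A^o)) : submod I ->
  (forall P, P \in Ps -> primeI P /\ ~ I `<=` P) ->
  exists2 x : A, I x & forall P, P \in Ps -> ~ P x.
Proof.
move=> sI; have [n] := ubnP (size Ps); elim: n Ps => // n IH [_ _|P Ps].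
  by exists 0 => //; exact: submod0 sI.
rewrite ltnS /= => sPs hPs; have [pP nIP] := hPs P (mem_head _ _).
(* Primes inside P are dropped, since avoiding P avoids them as well. *)
pose Ps' := [seq Q <- Ps | ~~ `[< Q `<=` P >]].
have Ps'E Q : Q \in Ps' -> Q \in Ps /\ ~ Q `<=` P.
  by rewrite mem_filter => /andP[/asboolPn].
have [||x Ix hx] := IH Ps'.
- by apply: leq_trans sPs; rewrite size_filter ltnS; exact: count_size.
- by move=> Q /Ps'E [QP _]; apply: hPs; rewrite inE QP orbT.
suff [z Iz [nPz hz]] : exists2 z : A, I z & ~ P z /\ forall Q, Q \in Ps' -> ~ Q z.
  exists z => // Q; rewrite inE => /orP[/eqP -> //|QP].
  have [h|h] := pselect (Q `<=` P); first by move/h.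
  by apply: hz; rewrite mem_filter QP andbT; apply/asboolPn.
have [Px|nPx] := pselect (P x); last by exists x.
(* If x lies in P, it is corrected by an element b of I that lies in all remaining primes but not in
   P. *)
have [||b nPb hb] := @common_element (I :: Ps') P => //.
  move=> Q; rewrite inE => /orP[/eqP -> //|/Ps'E[QP nQP]]; split=> //.
  by have [|[]] := hPs Q; rewrite // inE QP orbT.
have Ib : I b by apply: hb; rewrite mem_head.
exists (x + b); first exact: (submodD sI Ix Ib).
split; first by move/(submodDr (primeI_sub pP) Px).
move=> Q QP Qxb; apply: (hx Q QP); apply: (@submodDl A A^o Q x b _ _ Qxb).
  have [QP' _] := Ps'E Q QP.
  by have [|[]] := hPs Q; rewrite // inE QP' orbT.
by apply: hb; rewrite inE QP orbT.
Qed.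

(** Q contains the annihilator of 1, which is zero, so it contains a prime annihilator of some x; by
    minimality this prime is Q. *)
Lemma minimal_prime_assoc Q : noeth (setT : set A^o) -> primeI Q ->
  (forall P, primeI P -> P `<=` Q -> Q `<=` P) ->
  exists x : A, forall a : A, Q a <-> a * x = 0.
Proof.
move=> nA pQ mQ; have sQ := primeI_sub pQ.
have [||x [px xQ _]] := colon_prime (W := [set 0 : A^o]) (v0 := 1) nA _ pQ.
- exact: submod_zero.
- move=> a h; suff -> : a = 0 by exact: submod0 sQ.
  by rewrite -[a]mulr1; exact: h.
by exists x => a; split=> [/(mQ _ px xQ)|h]; [|apply: xQ].
Qed.

End PrimeChains.

Section Powers.
Variables (A : comPzRingType) (V : lmodType A).
Implicit Types (W : set V) (xs : seq A).

Lemma gsum_mul xs U n (b : A) (u : V) : submod U -> gsum xs (setT : set A^o) b ->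
  gpow xs U n u -> gpow xs U n.+1 (b *: u).
Proof.
move=> sU hb Uu; have sP := submod_gpow xs n.+1 sU.
apply: (@gsum_sub _ _ xs setT (colon (gpow xs U n.+1) u) (submod_colon u sP) _ _ hb).
move=> x c xxs _; rewrite /colon /= -[x *: c]/(x * c) -scalerA.
by apply: gsum_mem => //; [exact: submod_gpow|apply: submodZ => //; exact: submod_gpow].
Qed.

Lemma gpow_line xs n (b : A) (v : V) : gpow xs (setT : set A^o) n b ->
  gpow xs setT n (b *: v).
Proof.
move=> hb; have lf (a : A) (x z : A^o) :
    ((a *: x + z : A^o) : A) *: v = a *: ((x : A) *: v) + (z : A) *: v.
  by rewrite scalerDl -[a *: x]/(a * x) -scalerA.
have : ((fun b : A^o => (b : A) *: v) @` gpow xs setT n) (b *: v) by exists b.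
by rewrite gpow_im //; apply: gpow_mono.
Qed.

Lemma gpow_expr xs n x (v : V) : x \in xs -> gpow xs setT n (x ^+ n *: v).
Proof.
move=> xxs; elim: n => // n IH.
by rewrite exprS -scalerA; apply: gsum_mem => //; apply: submod_gpow.
Qed.

Lemma gpow_gsum_sub (ys zs : seq A) (U : set V) n : submod U ->
  (forall z, z \in zs -> gsum ys (setT : set A^o) z) -> gpow zs U n `<=` gpow ys U n.
Proof.
move=> sU zy; elim: n => // n IH; apply: gsum_sub; first exact: (submod_gpow _ n.+1).
by move=> z u /zy hz /IH; apply: gsum_mul.
Qed.

End Powers.

(** * Hilbert functions of prime quotients and chains of primes *)

Section LocalRing.
Variables (K : realType) (A : comPzRingType) (m : set A^o).
Hypotheses (nA : noeth (setT : set A^o)) (lm : local_at m).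
Implicit Types (Q P : set A^o).

Lemma prime_sub_max P : primeI P -> P `<=` m.
Proof. by case=> sP P1 _; apply: proper_sub_max. Qed.

Section Module.
Variable V : lmodType A.
Hypothesis nV : noeth (setT : set V).
Implicit Types (W : set V) (xs : seq A).

(** A prime factor of V / (W + I^n V) contains the annihilator of V / W and every x^n, hence every
    x, hence m; and A / m has finite length. *)
Lemma finlen_gpow W xs n : submod W ->
  (forall P, primeI P -> (forall a : A, (forall v, W (a *: v)) -> P a) ->
     (forall x, x \in xs -> P x) -> m `<=` P) ->
  finlen (sadd W (gpow xs setT n)) setT.
Proof.
move=> sW h; have sp := submod_gpow xs n (submodT V).
have sT : submod (sadd W (gpow xs setT n)) by apply: submod_sadd.
have [vs fvs] := ex_filt nA lm nV sT.
apply: (finlen_filt sT fvs) => Q QT; have pQ := fprimes_prime fvs QT.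
apply: finlen_mono (finlen_max lm) => //; apply: h => // [a ha|x xxs].
  by apply: (fprimes_ann sT QT) => v; apply: sadd_l.
apply: (primeI_exp pQ (n := n)); apply: (fprimes_ann sT QT) => v.
by apply: sadd_r => //; apply: gpow_expr.
Qed.

Lemma hilb_mono xs W n k : submod W -> (n <= k)%N ->
  finlen (sadd W (gpow xs setT k)) setT -> (hilb xs W n <= hilb xs W k)%N.
Proof.
move=> sW nk f; apply: ell_mono => //; try exact: submod_hilb.
by apply: sadd_mono => //; apply: gpow_le.
Qed.

Lemma hilb_line xs W v n : submod W -> finlen (sadd W (gpow xs setT n)) setT ->
  finlen (colon (sadd W (gpow xs setT n)) v) setT /\
  hilb xs W n = (ell (colon (sadd W (gpow xs setT n)) v) setT + hilb xs (sadd W (line v)) n)%N.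
Proof.
move=> sW f; have sT := submod_hilb xs n sW; have sl := submod_line v.
have [f1 ->] := line_transfer v sT; split.
  by apply/f1; apply: finlen_mono f.
have -> : hilb xs (sadd W (line v)) n = ell (sadd (sadd W (gpow xs setT n)) (line v)) setT.
  by rewrite /hilb -!saddA [sadd (line v) _]saddC.
by apply: ellD => //; [exact: submod_sadd|exact: sadd_l].
Qed.

(** The annihilator of v modulo W + I^n V contains (W : v) + I^n, so each filtration step
    contributes at most the value for A / (W : v). *)
Lemma filt_hilb_ub xs W vs n : submod W -> filt W vs ->
  finlen (sadd W (gpow xs setT n)) setT ->
  (forall Q, Q \in fprimes W vs -> finlen (sadd Q (gpow xs (setT : set A^o) n)) setT) ->
  (hilb xs W n <= \sum_(Q <- fprimes W vs) hilb xs Q n)%N.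
Proof.
elim: vs W => /= [|v vs IH] W sW; last first.
  move=> [pv fv] f fQ; rewrite big_cons; have sl := submod_line v.
  have [f1 ->] := hilb_line v sW f.
  apply: leq_add; last first.
    apply: IH => //; first exact: submod_sadd.
      by apply: finlen_mono f => //; apply: sadd_mono => //; apply: sadd_l.
    by move=> Q QW; apply: fQ; rewrite inE QW orbT.
  have sC := submod_colon v (submod_hilb xs n sW).
  apply: ell_mono => //; [|apply: sadd_sub => //|by apply: fQ; rewrite mem_head].
  - by apply: submod_hilb; apply: submod_colon.
  - by move=> a Wa; rewrite /colon /=; apply: sadd_l => //; apply: submod_gpow.
  - by move=> a Pa; rewrite /colon /=; apply: sadd_r => //; apply: gpow_line.
move=> -> _ _; rewrite big_nil /hilb leqn0.
have -> : sadd setT (gpow xs (setT : set V) n) = setT.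
  by apply/seteqP; split=> // u _; apply: sadd_l => //; apply: submod_gpow.
by rewrite ell_id.
Qed.

(** Artin-Rees puts (W + I^(n+c) V : v) inside (W : v) + I^n. As [hilb] increases with n, the
    largest of the constants met along the filtration serves all steps. *)
Lemma filt_hilb_lb xs W vs : submod W -> filt W vs ->
  (forall n, finlen (sadd W (gpow xs setT n)) setT) ->
  exists c, forall n, (\sum_(Q <- fprimes W vs) hilb xs Q n <= hilb xs W (n + c))%N.
Proof.
elim: vs W => /= [|v vs IH] W sW; first by exists 0%N => n; rewrite big_nil.
move=> [pv fv] f; have sl := submod_line v.
have [|//||c1 hc1] := IH (sadd W (line v)); first exact: submod_sadd.
  by move=> n; apply: finlen_mono (f n) => //; apply: sadd_mono => //; apply: sadd_l.
have [c2 hc2] := gpow_colon xs v nV sW.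
exists (maxn c1 c2) => n; rewrite big_cons.
have [f1 ->] := hilb_line v sW (f (n + maxn c1 c2)%N).
apply: leq_add; last first.
  apply: leq_trans (hc1 n) _; apply: hilb_mono; first exact: submod_sadd.
    by rewrite leq_add2l leq_maxl.
  by apply: finlen_mono (f (n + maxn c1 c2)%N) => //; apply: sadd_mono => //; apply: sadd_l.
apply: ell_mono => //.
- exact/submod_colon/submod_hilb.
- exact/submod_hilb/submod_colon.
move=> a ha; apply: hc2; move: ha; apply: sadd_mono => //.
by apply: gpow_le => //; rewrite leq_add2l leq_maxr.
Qed.

End Module.

Variable xs : seq A.
Hypotheses (mx : forall x, x \in xs -> m x)
  (xm : forall P, primeI P -> (forall x, x \in xs -> P x) -> m `<=` P).

Lemma finlen_xs (V : lmodType A) (W : set V) n : noeth (setT : set V) -> submod W ->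
  finlen (sadd W (gpow xs setT n)) setT.
Proof. by move=> nV sW; apply: finlen_gpow => // P pP _; exact: xm. Qed.

Lemma hilb_prime_gt0 P n : primeI P -> (0 < n)%N -> (0 < hilb xs P n)%N.
Proof.
move=> pP n0; have [sm m1 _] := lm.1.
apply: ell_gt0 => //; [exact/submod_hilb/primeI_sub| |exact/finlen_xs/primeI_sub].
split=> // h; apply: m1; suff : sadd P (gpow xs (setT : set A^o) n) `<=` m by apply; apply: h.
apply: sadd_sub => //; first exact: prime_sub_max.
move=> a /(gpow_le (submodT _) n0).
apply: gsum_sub => // x u /mx hx _; rewrite -[x *: u]/(x * u) mulrC; exact: idealZ.
Qed.

(* Artin-Rees for multiplication by an element of P1 outside P. *)
Lemma hilb_prime_step d P P1 : primeI P -> primeI P1 -> ssub P P1 ->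
  growth d (fun n => (hilb xs P n)%:R : K) ->
  exists2 r : {poly K}, (size r <= d)%N &
    exists c n0, forall n, (n0 <= n)%N -> (hilb xs P1 (n + c))%:R <= r.[n%:R].
Proof.
move=> pP pP1 [PP1 nP1P] gP; have sP := primeI_sub pP; have sP1 := primeI_sub pP1.
have [x P1x nPx] : exists2 x : A, P1 x & ~ P x.
  apply: contrapT => h; apply: nP1P => x P1x; apply: contrapT => nPx.
  by apply: h; exists x.
have sx := submod_sadd sP (submod_line (x : A^o)).
have cPx : colon P (x : A^o) `<=` P by move=> a; case: pP => _ _ PM /PM[].
have [c hc] := gpow_colon xs (x : A^o) nA sP.
(* The ring modulo P + I^(n+c) splits into the cyclic part generated by x and the quotient by x.
   Since (P : x) is contained in P, Artin-Rees bounds the first part below by H_P(n); the second is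
   at least H_P1(n+c) because x is in P1. *)
have key n : (hilb xs P n + hilb xs P1 (n + c) <= hilb xs P (n + c))%N.
  have [f1 ->] := hilb_line (x : A^o) sP (finlen_xs (n + c) nA sP).
  apply: leq_add; apply: ell_mono => //; try exact: submod_hilb.
  - exact/submod_colon/submod_hilb.
  - by apply: subset_trans (hc n) _; apply: sadd_mono.
  - apply: sadd_mono => //; apply: sadd_sub => //; exact: sub_line.
  - exact: finlen_xs.
have [p [sp [n0 hp]]] := @hilb_evp K A A^o xs P nA sP (fun n => finlen_xs n nA sP).
have {}sp := growth_size (fun n => ler0n _ _) hp gP.
exists (p \Po ('X + (c%:R)%:P) - p); first exact: size_shift_sub.
exists c, n0 => n n0n; rewrite hornerD hornerN horner_comp hornerD hornerX hornerC.
rewrite -natrD -!hp ?(leq_trans n0n) ?leq_addr //.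
by rewrite lerBrDr -natrD ler_nat addnC.
Qed.

(** Each strict inclusion of primes lowers the growth exponent by one. From exponent 0 a further
    step would make the Hilbert function of a prime eventually zero, while it is positive. *)
Lemma hilb_growth_dim d P k : primeI P -> growth d (fun n => (hilb xs P n)%:R : K) ->
  pch P k -> (k <= d)%N.
Proof.
elim: d P k => [|d IH] P [//|k] pP gP.
  move=> /pch_behead[P0 [P1 [pP0 pP1 PP0 [P01 nP10] ch]]].
  have PP1 : ssub P P1.
    by split; [exact: subset_trans P01|move=> h; apply: nP10 => x /h /PP0].
  have [r] := hilb_prime_step pP pP1 PP1 gP.
  rewrite size_poly_leq0 => /eqP -> [c [n0 hr]].
  have := hr n0.+1 (leqnSn _); rewrite horner0 lern0.
  have := @hilb_prime_gt0 P1 (n0.+1 + c) pP1; lia.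
move=> /pch_behead[P0 [P1 [pP0 pP1 PP0 [P01 nP10] ch]]].
have PP1 : ssub P P1.
  by split; [exact: subset_trans P01|move=> h; apply: nP10 => x /h /PP0].
have [r sr [c [n0 hr]]] := hilb_prime_step pP pP1 PP1 gP.
rewrite ltnS; apply: (IH P1) => //; have [C hC] := horner_growth sr.
exists `|C|, (n0.+1 + c)%N => n hn; have -> : n = ((n - c) + c)%N by lia.
apply: le_trans (hr _ _) _; first by lia.
apply: le_trans (ler_norm _) _; apply: le_trans (hC _ _) _; first by lia.
apply: le_trans (_ : `|C| * (n - c)%:R ^+ d <= _).
  by rewrite ler_wpM2r ?exprn_ge0 // ler_norm.
by rewrite ler_wpM2l // lerXn2r ?nnegrE // ler_nat leq_addr.
Qed.

(** The Hilbert polynomial has degree at most the number of generators xs; this is where finiteness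
    of the dimension comes from. *)
Lemma pch_bound (I : set A^o) k : pch I k -> (k <= size xs)%N.
Proof.
move=> [P [pP IP sP]]; have pP0 := pP 0%N.
apply: (@hilb_growth_dim _ (P 0%N)) => //; last by exists P; split.
by apply/evp_growth/hilb_evp => //; [exact: primeI_sub|move=> n; apply/finlen_xs/primeI_sub].
Qed.

(** A system of parameters of A / b lying inside the ideal (xs). Each new parameter avoids those
    factor primes of A / b that do not contain m, so that the bound on prime chains drops by one. *)
Lemma ex_parameters s (b : set A^o) : submod b -> (forall k, pch b k -> (k <= s)%N) ->
  exists zs : seq A, [/\ size zs = s, forall z, z \in zs -> gsum xs (setT : set A^o) z &
    forall P, primeI P -> b `<=` P -> (forall z, z \in zs -> P z) -> m `<=` P].
Proof.
elim: s b => [|s IH] b sb hb.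
  exists [::]; split=> // P pP bP _; apply: contrapT => nmP.
  have : pch b 1 by apply: pch_sub bP _; apply: (pch_cons pP _ (pch0 lm.1)); split=> //; exact: prime_sub_max.
  by move/hb.
have [vs fvs] := ex_filt nA lm nA sb.
pose Ps := [seq Q <- fprimes b vs | ~~ `[< m `<=` Q >]].
have [||x Ix hx] := @prime_avoidance A (gsum xs setT) Ps.
- exact: submod_gsum.
- move=> Q; rewrite mem_filter => /andP[/asboolPn nmQ /(fprimes_prime fvs) pQ]; split=> //.
  move=> h; apply: nmQ; apply: xm => // x xxs; apply: h.
  by rewrite -[x]mulr1; apply: gsum_mem.
have sl := submod_line (x : A^o).
have [||zs [szs hzs mzs]] := IH (sadd b (line (x : A^o))).
- exact: submod_sadd.
- move=> k [N [pN bN sN]].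
  have [|Q Qb QN] := @filt_cover _ _ b vs (N 0%N) sb fvs (pN 0%N).
    move=> a /(_ (1 : A^o)) ba; apply: bN; apply: sadd_l => //.
    by rewrite -[a]mulr1; exact: ba.
  have pQ := fprimes_prime fvs Qb.
  have bQ : b `<=` Q.
    move=> a ba; apply: (fprimes_ann sb Qb) => v; rewrite -[a *: v]/(a * v) mulrC.
    exact: idealZ.
  (* If Q contains m, then so does N 0, and the chain has length 0. Otherwise x is outside Q, so Q
     is strictly below N 0 and can be prepended, using up one of the s + 1 allowed inclusions. *)
  have [mQ|nmQ] := pselect (m `<=` Q).
    case: k sN => [//|k] /(_ 0%N isT)[_ []].
    by apply: subset_trans (prime_sub_max (pN _)) (subset_trans mQ QN).
  rewrite -ltnS; apply: hb; apply: pch_sub bQ _.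
  apply: (@pch_cons _ _ (N 0%N)) => //; last by exists N; split.
  split=> // h; apply: (hx Q); first by rewrite mem_filter Qb andbT; apply/asboolPn.
  by apply/h/bN/sadd_r => //; apply: line_id.
exists (x :: zs); split=> /=; first by rewrite szs.
  by move=> z; rewrite inE => /orP[/eqP -> //|]; exact: hzs.
move=> P pP bP hP; apply: mzs => //; last by move=> z zz; apply: hP; rewrite inE zz orbT.
apply: sadd_sub => //; first exact: primeI_sub.
by apply: sub_line; [exact: primeI_sub|apply: hP; rewrite mem_head].
Qed.

(** Replacing xs by s parameters inside (xs) makes the ideal smaller and the lengths larger, and for
    s generators the degree is at most s. *)
Lemma hilb_dim_growth s Q : submod Q -> (forall k, pch Q k -> (k <= s)%N) ->
  growth s (fun n => (hilb xs Q n)%:R : K).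
Proof.
move=> sQ hs; have [zs [szs zx mzs]] := ex_parameters sQ hs.
have fz n : finlen (sadd Q (gpow zs (setT : set A^o) n)) setT.
  apply: finlen_gpow => // P pP QP; apply: mzs => // a Qa; apply: QP => v.
  by rewrite -[a *: v]/(a * v) mulrC; apply: idealZ.
apply: (@growth_le K s _ (fun n => (hilb zs Q n)%:R)).
  move=> n; rewrite ler_nat; apply: ell_mono => //; try exact: submod_hilb.
  by apply: sadd_mono => //; apply: gpow_gsum_sub.
by rewrite -szs; apply/evp_growth/hilb_evp.
Qed.

End LocalRing.

(** * Multiplicities *)

Section PolynomialLimits.
Variable K : realType.

Lemma cvg_invn : (fun n => (n%:R : K)^-1) @ \oo --> (0 : K).
Proof. by rewrite -cvg_shiftS; exact: cvg_harmonic. Qed.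

Lemma horner_cvg (p : {poly K}) t : (size p <= t.+1)%N ->
  (fun n => p.[n%:R] / n%:R ^+ t) @ \oo --> p`_t.
Proof.
elim: t p => [|t IH] p sp.
  rewrite (size1_polyC sp) coefC eqxx.
  under eq_fun do rewrite hornerC expr0 divr1.
  exact: cvg_cst.
pose q : {poly K} := \poly_(i < t.+1) p`_i.+1.
have ep : p = q * 'X + (p`_0)%:P.
  apply/polyP => i; rewrite coefD coefMX coefC; case: i => [|i] /=; first by rewrite add0r.
  rewrite addr0 coef_poly; case: ltnP => // it.
  by rewrite nth_default // (leq_trans sp).
have qt : p`_t.+1 = q`_t by rewrite coef_poly ltnSn.
have h1 := IH q (size_poly _ _).
have hx : (fun n => (n%:R : K)^-1 ^+ t.+1) @ \oo --> (0 : K).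
  elim: t {IH sp q ep qt h1} => [|t IHt].
    by under eq_fun do rewrite expr1; exact: cvg_invn.
  rewrite -(mulr0 (0 : K)); under eq_fun do rewrite exprS.
  exact: cvgM cvg_invn IHt.
have h2 : (fun n => p`_0 * (n%:R : K)^-1 ^+ t.+1) @ \oo --> (0 : K).
  have h2 := cvgMl_tmp (a := p`_0) hx; rewrite mulr0 in h2; exact: h2.
rewrite qt -[X in _ --> X]addr0.
apply: cvg_trans (cvgD h1 h2); apply: near_eq_cvg; near=> n.
have n0 : (n%:R : K) != 0 by rewrite pnatr_eq0 -lt0n; near: n; exact: nbhs_infty_gt.
rewrite [in RHS]ep hornerD hornerM hornerX hornerC mulrDl [LHS]/GRing.add /=.
by rewrite exprVn; congr (_ + _); rewrite exprSr invfM mulrACA mulfV // mulr1.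
Unshelve. all: by end_near. Qed.

(** The lower bound on f is p(X - c), which has the same coefficient in degree t as the upper bound
    p. *)
Lemma squeeze_horner (f : nat -> K) (p : {poly K}) t c n0 : (size p <= t.+1)%N ->
  (forall n, (n0 <= n)%N -> p.[n%:R] <= f (n + c)%N) ->
  (forall n, (n0 <= n)%N -> f n <= p.[n%:R]) ->
  (fun n => f n / n%:R ^+ t) @ \oo --> p`_t.
Proof.
move=> sp h1 h2; pose q := p \Po ('X + (- (c%:R : K))%:P).
have sqp := size_shift_sub (- (c%:R : K)) sp.
have sq : (size q <= t.+1)%N.
  by rewrite -[q](subrK p); apply: size_polyD_leq => //; exact: leqW.
have qt : q`_t = p`_t.
  by apply/eqP; rewrite -subr_eq0 -coefB nth_default.
have cq := horner_cvg sq; rewrite qt in cq.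
apply: (squeeze_cvgr _ cq (horner_cvg sp)).
near=> n; have hn : (n0 + c <= n)%N by near: n; exact: nbhs_infty_ge.
have t0 : 0 <= ((n%:R : K) ^+ t)^-1 by rewrite invr_ge0 exprn_ge0.
rewrite !ler_wpM2r // ?h2 //; first by lia.
have := h1 (n - c)%N; rewrite subnK; last by lia.
rewrite /q horner_comp hornerD hornerX hornerC -natrB; last by lia.
by apply; lia.
Unshelve. all: by end_near. Qed.

Lemma sum_subset_le (I : eqType) (s r : seq I) (F : I -> K) :
  uniq s -> {subset s <= r} -> (forall i, i \in r -> 0 <= F i) ->
  \sum_(i <- s) F i <= \sum_(i <- r) F i.
Proof.
elim: s r => [|x s IH] r /=.
  by move=> _ _ F0; rewrite big_nil big_seq; apply: sumr_ge0.
move=> /andP[xs us] sr F0; have xr : x \in r by apply: sr; rewrite mem_head.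
rewrite big_cons (big_rem x xr) /= lerD2l; apply: IH => // [y ys|y /mem_rem /F0 //].
have := sr y; rewrite inE ys orbT => /(_ isT).
rewrite (perm_mem (perm_to_rem xr)) inE => /orP[/eqP e|//].
by rewrite -e ys in xs.
Qed.

(** Meant for s and r the factor primes of A and of a faithful module, F the coefficient of degree t
    of the Hilbert polynomial, and P the condition that the dimension is t. *)
Lemma sum_count_le (I : eqType) (s r : seq I) (F : I -> K) (P : pred I) (C : K) :
  0 <= C ->
  (forall i, i \in s -> P i -> (count_mem i s)%:R <= C) ->
  (forall i, i \in s -> P i -> i \in r) ->
  (forall i, i \in s -> ~~ P i -> F i = 0) ->
  (forall i, i \in s -> 0 <= F i) -> (forall i, i \in r -> 0 <= F i) ->
  \sum_(i <- s) F i <= C * \sum_(i <- r) F i.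
Proof.
move=> C0 hC hr hP Fs Fr; rewrite -big_undup_iterop_count.
apply: le_trans (_ : \sum_(i <- undup s | P i) C * F i <= _).
  rewrite [leRHS]big_mkcond /= big_seq [leRHS]big_seq; apply: ler_sum => i.
  rewrite mem_undup => si; rewrite -/(F i *+ count_mem i s) -[F i *+ _]mulr_natl.
  case: ifPn => Pi; last by rewrite hP // mulr0.
  by rewrite ler_wpM2r ?Fs ?hC.
rewrite -mulr_sumr ler_wpM2l // -big_filter; apply: sum_subset_le => //.
  by rewrite filter_uniq // undup_uniq.
by move=> i; rewrite mem_filter mem_undup => /andP[Pi si]; apply: hr.
Qed.

End PolynomialLimits.

Section Multiplicity.
Variables (K : realType) (A : comPzRingType) (m : set A^o).
Hypotheses (nA : noeth (setT : set A^o)) (lm : local_at m).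
Variable xs : seq A.
Hypothesis xm : forall P, primeI P -> (forall x, x \in xs -> P x) -> m `<=` P.
Variable t : nat.
Hypothesis tP : forall k, pch [set 0 : A^o] k -> (k <= t)%N.

(** A single choice of polynomials for all primes, so that filtrations of different modules are
    compared through the same coefficients. *)
Lemma ex_hilbert_polys : exists hp : set A^o -> {poly K}, forall Q, primeI Q ->
  [/\ (size (hp Q) <= t.+1)%N,
      exists n0, forall n, (n0 <= n)%N -> (hilb xs Q n)%:R = (hp Q).[n%:R] &
      ~ pch Q t -> (hp Q)`_t = 0].
Proof.
suff h Q : exists p : {poly K}, primeI Q -> [/\ (size p <= t.+1)%N,
  exists n0, forall n, (n0 <= n)%N -> (hilb xs Q n)%:R = p.[n%:R] &
  ~ pch Q t -> p`_t = 0] by have [hp hpP] := choice h; exists hp.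
have [pQ|nQ] := pselect (primeI Q); last by exists 0.
have sQ := primeI_sub pQ.
have [p [_ [n0 hp]]] := @hilb_evp K A A^o xs Q nA sQ (fun n => finlen_xs nA lm xm n nA sQ).
have bd s : (forall k, pch Q k -> (k <= s)%N) -> (size p <= s.+1)%N.
  move=> hs; apply: (growth_size _ hp) => //.
  exact: (hilb_dim_growth K nA lm xm sQ hs).
have Q0 : [set 0] `<=` Q by move=> _ ->; apply: submod0.
exists p => _; split; [|by exists n0|].
  by apply: bd => k /(pch_sub Q0); exact: tP.
(* Every prime has a chain of length 0 above it, so t > 0 here and t - 1 bounds the chains above
   Q. *)
move=> nQt; have t0 : (0 < t)%N.
  by rewrite lt0n; apply/eqP => e; apply: nQt; rewrite e; exact: pch0.
apply: nth_default; rewrite -(prednK t0); apply: bd => k hk.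
rewrite -ltnS prednK // ltn_neqAle (tP (pch_sub Q0 hk)) andbT.
by apply/eqP => e; apply: nQt; rewrite -e.
Qed.

(* The additivity formula for multiplicities. *)
Lemma hilb_cvg (hp : set A^o -> {poly K}) (V : lmodType A) (vs : seq V) :
  (forall Q, primeI Q -> [/\ (size (hp Q) <= t.+1)%N,
      exists n0, forall n, (n0 <= n)%N -> (hilb xs Q n)%:R = (hp Q).[n%:R] &
      ~ pch Q t -> (hp Q)`_t = 0]) ->
  noeth (setT : set V) -> filt [set 0] vs ->
  (fun n => (hilb xs [set 0 : V] n)%:R / n%:R ^+ t) @ \oo -->
    \sum_(Q <- fprimes [set 0] vs) (hp Q)`_t.
Proof.
move=> hpP nV fvs; have s0 : submod [set 0 : V] by exact: submod_zero.
have fl n : finlen (sadd [set 0] (gpow xs (setT : set V) n)) setT.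
  exact: (finlen_xs nA lm xm).
have [c hc] := filt_hilb_lb nV s0 fvs fl.
have pr Q : Q \in fprimes [set 0] vs -> primeI Q by apply: fprimes_prime.
pose p := \sum_(Q <- fprimes [set 0] vs) hp Q.
have [n0 hn0] : exists n0, forall n, (n0 <= n)%N ->
    (\sum_(Q <- fprimes [set 0] vs) hilb xs Q n)%:R = p.[n%:R].
  rewrite /p; elim: (fprimes _ _) pr => [|Q s IH] pr.
    by exists 0%N => n _; rewrite !big_nil horner0.
  have [|n1 h1] := IH; first by move=> Q' Q's; apply: pr; rewrite inE Q's orbT.
  have [_ [n2 h2] _] := hpP Q (pr Q (mem_head _ _)).
  exists (maxn n1 n2) => n; rewrite geq_max => /andP[nn1 nn2].
  by rewrite !big_cons natrD hornerD h1 // h2.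
have sp : (size p <= t.+1)%N.
  rewrite /p big_seq; apply: (big_ind (fun r : {poly K} => (size r <= t.+1)%N)).
  - by rewrite size_poly0.
  - by move=> x y; apply: size_polyD_leq.
  - by move=> Q /pr /hpP[].
rewrite -coef_sum; apply: (@squeeze_horner K _ p t c n0) => // n hn.
  by rewrite -hn0 // ler_nat; apply: hc.
rewrite -hn0 // ler_nat; apply: filt_hilb_ub => // Q /pr /primeI_sub sQ.
exact: (finlen_xs nA lm xm).
Qed.

Lemma hilb_cvg_ge0 (V : lmodType A) (W : set V) l :
  (fun n => (hilb xs W n)%:R / n%:R ^+ t : K) @ \oo --> l -> 0 <= l.
Proof.
move=> h; apply: (ler_cvg_to (cvg_cst (0 : K)) h).
by near=> n; rewrite divr_ge0 ?exprn_ge0.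
Unshelve. all: by end_near. Qed.

Lemma multiplicity_le (V : lmodType A) (vs : seq A^o) (C : K) :
  noeth (setT : set V) -> (forall a : A, (forall v : V, a *: v = 0) -> a = 0) ->
  filt [set 0] vs -> 0 <= C ->
  (forall Q, Q \in fprimes [set 0] vs -> pch Q t ->
    (count_mem Q (fprimes [set 0] vs))%:R <= C) ->
  exists eA eV : K, [/\ 0 <= eA, 0 <= eV, eA <= C * eV,
    (fun n => (hilb xs [set 0 : A^o] n)%:R / n%:R ^+ t) @ \oo --> eA &
    (fun n => (hilb xs [set 0 : V] n)%:R / n%:R ^+ t) @ \oo --> eV].
Proof.
move=> nV fV fvs C0 hC; have [hp hpP] := ex_hilbert_polys.
have s0 : submod [set 0 : V] by exact: submod_zero.
have [us fus] := ex_filt nA lm nV s0.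
have cA := hilb_cvg hpP nA fvs; have cV := hilb_cvg hpP nV fus.
exists (\sum_(Q <- fprimes [set 0] vs) (hp Q)`_t), (\sum_(Q <- fprimes [set 0] us) (hp Q)`_t).
have hp0 Q : primeI Q -> 0 <= (hp Q)`_t.
  move=> pQ; have [sQ [n0 hn0] _] := hpP Q pQ.
  apply: (@hilb_cvg_ge0 A^o Q); apply: cvg_trans (horner_cvg sQ); apply: near_eq_cvg.
  by near=> n; rewrite hn0 //; near: n; exact: nbhs_infty_ge.
split=> //; [exact: hilb_cvg_ge0 cA|exact: hilb_cvg_ge0 cV|].
apply: (@sum_count_le _ _ _ _ _ (fun Q => `[< pch Q t >])) => //.
- by move=> Q Qs /asboolP; apply: hC.
- move=> Q /(fprimes_prime fvs) pQ /asboolP Qt.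
  (* As V is faithful, Q contains some factor prime Q' of V; the chain of length t above Q forces Q'
     = Q. *)
  have [|Q' Q's Q'Q] := @filt_cover _ _ [set 0] us Q s0 fus pQ.
  + by move=> a /fV ->; exact: submod0 (primeI_sub pQ).
  have pQ' := fprimes_prime fus Q's.
  suff -> : Q = Q' by [].
  apply/seteqP; split=> //; apply: (pch_max_sub pQ' _ Q'Q tP Qt).
  by move=> _ ->; exact: submod0 (primeI_sub pQ').
- by move=> Q /(fprimes_prime fvs) /hpP[_ _ h] /asboolPn; exact: h.
- by move=> Q /(fprimes_prime fvs); exact: hp0.
- by move=> Q /(fprimes_prime fus); exact: hp0.
Unshelve. all: by end_near. Qed.

End Multiplicity.

(** * The invariants in terms of sets of submodules *)

Lemma supremumsP (S : set nat) b : S b -> (forall k, S k -> (k <= b)%N) ->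
  supremum 0%N S = b.
Proof.
move=> Sb hb; have h : supremums S b by split; [move=> k /hb|move=> c; apply].
rewrite /supremum; case: ifPn => [/eqP e|_]; first by rewrite e in Sb.
exact: (is_subset1_supremums (xgetPex 0%N (ex_intro _ b h)) h).
Qed.

Lemma nat_supE (S : set nat) b : S b -> (forall k, S k -> (k <= b)%N) ->
  nat_sup S = b%:E.
Proof.
move=> Sb hb; rewrite /nat_sup; case: ifPn => [/eqP e|_]; first by rewrite e in Sb.
case: asboolP => [_|[]]; first by rewrite (supremumsP Sb hb).
by exists b => k /hb.
Qed.

Lemma nat_sup_ub (S : set nat) k : S k -> nat_sup S = +oo%E \/
  exists2 b, nat_sup S = b%:E & (k <= b)%N.
Proof.
move=> Sk; have [[b hb]|nb] := pselect (has_ubound S).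
  have [||Sn hn] := @natmaxP S b; [by exists k|by move=> l /hb|].
  by right; exists (natmax S); [exact: nat_supE|exact: hn].
left; rewrite /nat_sup; case: ifPn => [/eqP e|_]; first by rewrite e in Sk.
by case: asboolP.
Qed.

Lemma set_submod (A : comPzRingType) (V : lmodType A) (U : set V) : submod U ->
  {N : submodClosed V | [set x | x \in N] = U}.
Proof. by move=> sU; exists (spanm U : submodClosed V); exact: mem_spanmP. Qed.

Section LengthBridge.
Variables (K : realType) (A : comPzRingType) (V : lmodType A).

Lemma length_chain : length V = nat_sup [set k | chain [set 0 : V] setT k].
Proof.
congr nat_sup; apply/seteqP; split=> k /= [N].
  move=> hN; exists (fun i => [set x | x \in N i]); split=> //.
  - by move=> i; exact: submod_mem.
  - by move=> _ -> /=; exact: rpred0.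
move=> [sN _ _ hN]; pose N' i : submodClosed V := sval (set_submod (sN i)).
have N'E i x : (x \in N' i) = N i x :> Prop.
  by have /seteqP := svalP (set_submod (sN i)) => -[h1 h2]; apply/propext; split=> [/h1|/h2].
exists N' => i ik; have [h1 h2] := hN i ik; split; first by move=> x; rewrite !N'E; exact: h1.
by move=> h; apply: h2 => x; rewrite -!N'E; exact: h.
Qed.

Lemma len_ell : finlen [set 0 : V] setT -> len K V = ((ell [set 0 : V] setT)%:R)%:E.
Proof.
move=> f; have [c h] := ellP (@submod_zero A V) (fun x e => I) f.
by rewrite /len length_chain (nat_supE (S := [set k | chain _ _ k]) c h).
Qed.

Lemma len_chain_le k : chain [set 0 : V] setT k -> ((k%:R)%:E <= len K V)%E.
Proof.
rewrite /len length_chain => h.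
have [->|[b -> kb]] := @nat_sup_ub [set k | chain [set 0 : V] setT k] k h; first exact: leey.
by rewrite /= lee_fin ler_nat.
Qed.

End LengthBridge.

Section QmodLength.
Variables (K : realType) (A : comPzRingType) (V : lmodType A) (N : submodClosed V).

Lemma qmod_pi_linear (a : A) (x y : V) :
  qmod_pi N (a *: x + y) = a *: qmod_pi N x + qmod_pi N y.
Proof. by rewrite qmod_piD; congr (_ + _); apply/esym; exact: qmod_scale_pi. Qed.

Lemma qmod_transfer :
  (finlen [set x | x \in N] setT <-> finlen [set 0 : qmod N] setT) /\
  ell [set x | x \in N] setT = ell [set 0 : qmod N] setT.
Proof.
have -> : [set x | x \in N] = [set u | setT u /\ [set 0 : qmod N] (qmod_pi N u)].
  apply/seteqP; split=> x /=; rewrite -(qmod_pi0 N).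
    by move=> xN; split=> //; apply/qmod_piP; rewrite subr0.
  by move=> [_ /qmod_piP]; rewrite subr0.
have sur : (setT : set (qmod N)) `<=` sadd (qmod_pi N @` setT) [set 0].
  move=> x _; apply: sadd_l; first exact: submod_zero.
  by exists (qmod_repr x) => //; exact: qmod_reprK.
split.
  by apply: (finlen_transfer qmod_pi_linear) => //; exact: submod_zero.
by apply: (ell_transfer qmod_pi_linear) => //; exact: submod_zero.
Qed.

Lemma len_qmod : finlen [set x | x \in N] setT ->
  len K (qmod N) = ((ell [set x | x \in N] setT)%:R)%:E.
Proof. have [h ->] := qmod_transfer; by move=> /h f; rewrite len_ell. Qed.

End QmodLength.

Section PowerBridge.
Variables (A : comPzRingType) (I : ideal A) (xs : seq A).
Hypothesis Ixs : [set a : A^o | a \in I] = lspan (xs : seq A^o).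

Lemma mem_smul (V : lmodType A) (N : submodClosed V) :
  [set v | v \in smul I N] = gsum xs [set v | v \in N].
Proof.
have sN := submod_mem N; apply/seteqP; split.
  apply: spanm_sub; first exact: submod_gsum.
  move=> _ [a [x [aI xN ->]]].
  have : lspan (xs : seq A^o) a by rewrite -Ixs.
  have sc : submod (colon (gsum xs [set v | v \in N]) x) by apply/submod_colon/submod_gsum.
  by apply: (lspan_sub sc) => b bxs; rewrite /colon /=; apply: gsum_mem.
apply: gsum_sub; first exact: submod_mem.
move=> x u xxs uN; apply: mem_spanm; exists x, u; split=> //.
by have : lspan (xs : seq A^o) x by [apply: lspan_mem]; rewrite -Ixs.
Qed.

Lemma mem_whole (V : lmodType A) : [set v | v \in whole V] = setT.
Proof. by apply/seteqP. Qed.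

Lemma mem_ipow n : [set a : A^o | a \in ipow I n] = gpow xs (setT : set A^o) n.
Proof. by elim: n => [|n IH]; rewrite ?mem_whole // [LHS]mem_smul IH. Qed.

(** [powm] forms the ideal I^n before letting it act on V, whereas [gpow] applies I to V n times. *)
Lemma mem_powm (V : lmodType A) n :
  [set v | v \in powm I V n] = gpow xs (setT : set V) n.
Proof.
apply/seteqP; split.
  apply: spanm_sub; first exact: submod_gpow.
  move=> _ [a [x [aI _ ->]]]; apply: gpow_line.
  by rewrite -mem_ipow.
have sP k : submod [set v | v \in powm I V k] := submod_mem _.
elim: n => [|n IH].
  move=> x _; apply: mem_spanm; exists 1, x; rewrite scale1r; split=> //.
apply: gsum_sub; first exact: sP.
move=> x u xxs /IH Pu.
have xI : x \in I.
  by have : lspan (xs : seq A^o) x by [apply: lspan_mem]; rewrite -Ixs.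
suff hs : [set v | v \in powm I V n] `<=` [set v | x *: v \in powm I V n.+1].
  exact: hs.
have h : submod [set v | x *: v \in powm I V n.+1].
  have lx (a : A) (u1 v1 : V) : x *: (a *: u1 + v1) = a *: (x *: u1) + x *: v1.
    by rewrite scalerDr !scalerA mulrC.
  have := submod_preim lx (submodT V) (sP n.+1).
  by congr submod; apply/seteqP; split=> [v []|v].
apply: (spanm_sub h) => _ [a [v [aI _ ->]]] /=; rewrite scalerA.
apply: mem_spanm; exists (x * a), v; split=> //.
by apply: mem_spanm; exists x, a.
Qed.

End PowerBridge.

Section SpecBridge.
Variable A : comPzRingType.

Lemma spec_primeI (P : spec A) : primeI [set a : A^o | a \in P].
Proof.
case: P => P [P1 PM] /=; split; [exact: submod_mem|exact/negP|exact: PM].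
Qed.

Lemma primeI_spec (Q : set A^o) : primeI Q -> {P : spec A | [set a : A^o | a \in P] = Q}.
Proof.
move=> [sQ Q1 QM]; have e := mem_spanmP sQ.
have mE a : (a \in spanm Q) = Q a :> Prop by rewrite -[RHS](congr1 (fun U => U a) e).
have pQ : is_prime (spanm Q : ideal A).
  split; first by apply/negP; rewrite mE.
  by move=> a b; rewrite !mE; exact: QM.
by exists (Spec pQ).
Qed.

Lemma kdim_pch : kdim A = nat_sup [set k | pch [set 0 : A^o] k].
Proof.
congr nat_sup; apply/seteqP; split=> k /= [P].
  move=> sP; exists (fun i => [set a : A^o | a \in P i]); split=> //.
    by move=> i; exact: spec_primeI.
  by move=> _ -> /=; exact: rpred0.
move=> [pP _ sP]; pose P' i := sval (primeI_spec (pP i)).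
have PE i x : (x \in P' i) = P i x :> Prop.
  by have /seteqP := svalP (primeI_spec (pP i)) => -[h1 h2]; apply/propext; split=> [/h1|/h2].
exists P' => i ik; have [h1 h2] := sP i ik; split; first by move=> x; rewrite !PE; exact: h1.
by move=> h; apply: h2 => x; rewrite -!PE; exact: h.
Qed.

End SpecBridge.

Section QuotientRingBridge.
Variables (A : comPzRingType) (I : ideal A).
Local Notation pi := (qring_pi I).

Lemma qring_piM a b : pi (a * b) = pi a * pi b.
Proof. by apply/esym; exact: qring_mul_pi. Qed.

Lemma qring_pi0 : pi 0 = 0. Proof. exact: qmod_pi0. Qed.

Lemma qring_pi_mem a : pi a = 0 <-> a \in I.
Proof. by rewrite -qring_pi0 (qring_piP I a 0) subr0. Qed.

Lemma qring_ind (P : qring I -> Prop) : (forall a, P (pi a)) -> forall x, P x.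
Proof. by move=> h x; rewrite -[x]qring_reprK; exact: h. Qed.

Lemma submod_pi_preim (Q : set (qring I)^o) : submod Q ->
  submod (pi @^-1` Q : set A^o).
Proof.
move=> sQ; split; first by rewrite /preimage /= qring_pi0; exact: submod0 sQ.
move=> a x y Qx Qy; rewrite /preimage /= -[a *: x]/(a * x) qring_piD.
by rewrite [X in X + _]qring_piM; exact: sQ.2.
Qed.

Lemma submod_pi_im (U : set A^o) : submod U -> submod (pi @` U : set (qring I)^o).
Proof.
move=> sU; split; first by exists 0; [exact: submod0|exact: qring_pi0].
move=> x _ _ [a Ua <-] [b Ub <-]; elim/qring_ind: x => c.
exists (c * a + b); first exact: (submodD sU (idealZ c sU Ua) Ub).
by rewrite qring_piD [X in X + _]qring_piM.
Qed.

Lemma primeI_pi_preim (Q : set (qring I)^o) : primeI Q -> primeI (pi @^-1` Q : set A^o).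
Proof.
move=> [sQ Q1 QM]; split; [exact: submod_pi_preim|exact: Q1|].
by move=> a b; rewrite /preimage /= qring_piM => /QM.
Qed.

Lemma pi_im_preim (Q : set (qring I)^o) : pi @` (pi @^-1` Q) = Q.
Proof.
apply/seteqP; split; first by move=> _ [a Qa <-].
by move=> x; elim/qring_ind: x => a Qa; exists a.
Qed.

Lemma pi_preim_im (U : set A^o) : submod U -> [set a | a \in I] `<=` U ->
  pi @^-1` (pi @` U) = U.
Proof.
move=> sU IU; apply/seteqP; split; last by move=> a Ua; exists a.
move=> a [b Ub /qring_piP e]; rewrite -[a](subKr b); apply: submodB => //; exact: IU.
Qed.

Lemma primeI_pi_im (U : set A^o) : [set a | a \in I] `<=` U -> primeI U ->
  primeI (pi @` U : set (qring I)^o).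
Proof.
move=> IU [sU U1 UM]; have e a : (pi @` U) (pi a) = U a.
  by rewrite -[in RHS](pi_preim_im sU IU).
split; [exact: submod_pi_im|by rewrite [X in ~ X]e|].
by elim/qring_ind=> a; elim/qring_ind=> b; rewrite -qring_piM !e; exact: UM.
Qed.

Lemma kdim_qring : kdim (qring I) = nat_sup [set k | pch [set a : A^o | a \in I] k].
Proof.
rewrite kdim_pch; congr nat_sup; apply/seteqP; split=> k /= [P [pP IP sP]].
  exists (fun i => pi @^-1` P i); split.
  - by move=> i; exact: primeI_pi_preim.
  - by move=> a aI; rewrite /preimage /=; apply: IP; apply/qring_pi_mem.
  move=> i ik; have [h1 h2] := sP i ik; split; first by move=> a; exact: h1.
  by move=> h; apply: h2 => x; elim/qring_ind: x => a; exact: h.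
have mono i : (i <= k)%N -> P 0%N `<=` P i by move=> ik; exact: (ssub_mono sP).
(* Beyond k the primes P i need not contain I, and then their images need not be prime; the sequence
   is frozen at P k. *)
pose Q i := if (i <= k)%N then P i else P k.
have IQ i : [set a | a \in I] `<=` Q i.
  by rewrite /Q; case: ifP => ik; apply: subset_trans IP _; apply: mono.
have pQ i : primeI (Q i) by rewrite /Q; case: ifP.
exists (fun i => pi @` Q i); split.
- by move=> i; exact: primeI_pi_im.
- by move=> _ ->; exact: submod0 (primeI_sub (primeI_pi_im (IQ _) (pQ _))).
move=> i ik; rewrite /Q ik (ltnW ik); have [h1 h2] := sP i ik; split.
  by move=> _ [a Pa <-]; exists a => //; exact: h1.
move=> h; apply: h2 => a Pa.
have e : pi @^-1` (pi @` P i) = P i.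
  apply: pi_preim_im; first exact: primeI_sub.
  by have := IQ i; rewrite /Q (ltnW ik).
by rewrite -e; apply: h; exists a.
Qed.

End QuotientRingBridge.

(** * Multiplicity of a prime in a filtration and length of the localization *)

Section LocalizationLength.
Variables (K : realType) (A : comPzRingType) (P : spec A).

Definition loc_ext (W : set A^o) : set (loc P)^o :=
  [set q | exists a (s : {s : A | s \notin P}), W a /\ q = loc_pi ((a : A, s) : fraction P)].

Lemma submod_loc_ext (W : set A^o) : submod W -> submod (loc_ext W).
Proof.
move=> sW; split.
  by exists 0, (exist _ 1 (spec1 P)); split; [exact: submod0 sW|].
move=> r _ _ [a [s [Wa ->]]] [b [u [Wb ->]]]; rewrite -[r]loc_reprK.
case: (loc_repr r) => c v.
exists (val u * (c * a) + val v * val s * b),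
  (exist _ (val v * val s * val u) (specM (specM (valP v) (valP s)) (valP u))).
split.
  exact: (submodD sW (idealZ _ sW (idealZ c sW Wa)) (idealZ _ sW Wb)).
rewrite -[_ *: _]/(loc_mul _ _) -[_ + _]/(loc_add _ _) loc_mul_pi loc_add_pi.
by apply/loc_piP/frac_eqW; rewrite /frac_add /frac_mul /den /=; ring.
Qed.

(** A factor A / P stays nonzero after localization at P: if v/1 = a/s with a in W, then some u
    outside P has u s v in W, so u s lies in (W : v) = P, which is impossible. Factors with other
    primes may collapse and are not counted. *)
Lemma count_chain_loc (W : set A^o) (vs : seq A^o) : submod W -> filt W vs ->
  chain (loc_ext W) setT (count_mem [set a : A^o | a \in P] (fprimes W vs)).
Proof.
elim: vs W => [|v vs IH] W sW /=.
  by move=> _; apply: chain0 => //; exact: submod_loc_ext.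
move=> [pv fv]; have sl := submod_line v; have sWl := submod_sadd sW sl.
have mono : loc_ext W `<=` loc_ext (sadd W (line v)).
  by move=> _ [a [s [Wa ->]]]; exists a, s; split=> //; exact: sadd_l.
case: eqP => [e|_] /=; last by rewrite add0n; apply: chain_mono (IH _ sWl fv).
rewrite add1n; apply: (@chain_cons _ _ _ (loc_ext (sadd W (line v)))); last exact: IH.
- exact: submod_loc_ext.
- exact: submod_loc_ext.
split=> // h; have := h (loc_pi ((v : A, exist _ 1 (spec1 P)) : fraction P)).
case; first by exists v, (exist _ 1 (spec1 P)); split=> //; apply: sadd_r => //; exact: line_id.
move=> a [s [Wa /loc_piP/asboolP[u uP /=]]]; rewrite /den /= mulr1 mulrBr.
move=> /eqP; rewrite subr_eq0 => /eqP us.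
have : colon W v (u * val s).
  rewrite /colon /= -[_ *: v]/(u * val s * v) -mulrA [val s * v]mulrC us.
  exact: idealZ.
rewrite e /= => usP; have := specM uP (valP s); by rewrite usP.
Qed.

Lemma count_le_len (vs : seq A^o) : filt [set 0] vs ->
  (((count_mem [set a : A^o | a \in P] (fprimes [set 0] vs))%:R)%:E <= len K (loc P)^o)%E.
Proof.
move=> fvs; apply: len_chain_le.
apply: chain_mono (count_chain_loc (@submod_zero A A^o) fvs) => //.
move=> _ ->; exact: submod0 (submod_loc_ext (@submod_zero A A^o)).
Qed.

End LocalizationLength.

Section GeneratorBound.
Variables (A : comPzRingType) (V : lmodType A).

Lemma ell_lspan_le (T : set V) (vs : seq V) L : submod T ->
  finlen T setT -> (forall W v, submod W -> T `<=` W -> (ell (colon W v) setT <= L)%N) ->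
  (ell T (sadd T (lspan vs)) <= size vs * L)%N.
Proof.
move=> sT f hL; elim: vs => [|v vs IH] /=.
  by rewrite saddC sadd_absorb ?ell_id //; [exact: submod_zero|move=> _ ->; exact: submod0].
have sl := submod_line v; have ss := submod_lspan vs; have sTs := submod_sadd sT ss.
rewrite saddA (@ellD _ _ T (sadd T (lspan vs))) //.
- rewrite mulSn addnC; apply: leq_add => //.
  by have [_ <-] := line_transfer v sTs; apply: hL => //; exact: sadd_l.
- exact: submod_sadd.
- exact: sadd_l.
- exact: sadd_l.
- exact: finlen_mono f.
Qed.

(** Adding the generators to I V one at a time gives cyclic factors, each a quotient of A / I. *)
Lemma ell_gsum_le xs (vs : seq V) : lspan vs = setT ->
  finlen (gsum xs (setT : set V)) setT -> finlen (gsum xs (setT : set A^o)) setT ->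
  (ell (gsum xs (setT : set V)) setT <= size vs * ell (gsum xs (setT : set A^o)) setT)%N.
Proof.
move=> vT f fA; have sg := submod_gsum xs (submodT V).
have h : sadd (gsum xs setT) (lspan vs) = setT.
  by rewrite vT; apply/seteqP; split=> // x _; apply: sadd_r.
have := @ell_lspan_le _ vs (ell (gsum xs (setT : set A^o)) setT) sg f.
rewrite h; apply=> W v sW gW.
apply: ell_mono => //; [exact: submod_gsum|exact: submod_colon|].
by move=> a ha; apply: gW; apply: (@gpow_line _ _ xs 1).
Qed.

End GeneratorBound.

(** * Passage from R to R / ann M *)

Section AnnihilatorQuotientModule.
Variables (R : comPzRingType) (V : lmodType R).

(* V regarded as a module over R / ann V. *)
Definition qact : Type := V.
HB.instance Definition _ := GRing.Zmodule.on qact.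

Definition qact_scale (a : qring (ann V)) (x : qact) : qact := qring_repr a *: (x : V).

Lemma annP (a : R) : a \in ann V <-> forall x : V, a *: x = 0.
Proof. by split=> /asboolP. Qed.

Lemma qact_scale_pi (a : R) (x : V) : qact_scale (qring_pi (ann V) a) x = a *: x.
Proof.
apply/eqP; rewrite -subr_eq0 -scalerBl; apply/eqP; move: x; apply/annP.
by apply/qring_piP; rewrite qring_reprK.
Qed.

Fact qact_scaleA a b x : qact_scale a (qact_scale b x) = qact_scale (a * b) x.
Proof.
elim/qring_ind: a => a; elim/qring_ind: b => b.
by rewrite -qring_piM !qact_scale_pi [LHS]scalerA.
Qed.
Fact qact_scale1 : left_id 1 qact_scale.
Proof. by move=> x; rewrite -[1]/(qring_pi (ann V) 1) qact_scale_pi scale1r. Qed.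
Fact qact_scaleDr : right_distributive qact_scale +%R.
Proof. by move=> a x y; exact: scalerDr. Qed.
Fact qact_scaleDl x : {morph qact_scale^~ x : a b / a + b}.
Proof.
move=> a b; elim/qring_ind: a => a; elim/qring_ind: b => b.
by rewrite -qring_piD !qact_scale_pi [LHS]scalerDl.
Qed.
HB.instance Definition _ := GRing.Zmodule_isLmodule.Build (qring (ann V)) qact
  qact_scaleA qact_scale1 qact_scaleDr qact_scaleDl.

Lemma qact_piZ (a : R) (x : V) : qring_pi (ann V) a *: (x : qact) = a *: x.
Proof. exact: qact_scale_pi. Qed.

(** [qact] and V share their carrier, so a set of one is a set of the other; submodules, chains and
    lengths then agree without any transport. *)
Lemma submod_qact (U : set V) : submod (U : set qact) = submod U.
Proof.
apply/propext; split=> -[U0 h]; split=> //.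
  by move=> a x y Ux Uy; rewrite -qact_piZ; exact: h.
move=> a x y Ux Uy; elim/qring_ind: a => a.
by rewrite qact_piZ; exact: h.
Qed.

Lemma chain_qact (W U : set V) k : chain (W : set qact) U k = chain W U k.
Proof.
apply/propext; split=> -[N [sN WN NU sm]]; exists N; split=> // i;
  by [rewrite -submod_qact|rewrite submod_qact].
Qed.

Lemma ell_qact (W U : set V) : ell (W : set qact) U = ell W U.
Proof. by rewrite /ell; congr natmax; apply/funext => k /=; exact: chain_qact. Qed.

Lemma finlen_qact (W U : set V) : finlen (W : set qact) U -> finlen W U.
Proof. by move=> [b hb]; exists b => k; rewrite -chain_qact; exact: hb. Qed.

Lemma gsum_qact (xs : seq R) (U : set V) :
  gsum (map (qring_pi (ann V)) xs) (U : set qact) = gsum xs U.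
Proof.
elim: xs => //= x xs ->.
have -> // : scale_set (qring_pi (ann V) x) (U : set qact) = scale_set x U.
by rewrite /scale_set; congr image; apply/funext => u; exact: qact_piZ.
Qed.

Lemma gpow_qact (xs : seq R) n :
  gpow (map (qring_pi (ann V)) xs) (setT : set qact) n = gpow xs (setT : set V) n.
Proof. by elim: n => // n IH; rewrite /gpow !iterS [X in gsum _ X]IH gsum_qact. Qed.

Lemma line_qact (v : V) : line (v : qact) = line v.
Proof.
apply/seteqP; split=> _ [a ->].
  by elim/qring_ind: a => a; exists a; exact: qact_piZ.
by exists (qring_pi (ann V) a); rewrite qact_piZ.
Qed.

Lemma lspan_qact (vs : seq V) : lspan (vs : seq qact) = lspan vs.
Proof. by elim: vs => //= v vs ->; rewrite line_qact. Qed.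

Lemma qact_faithful (a : qring (ann V)) : (forall v : qact, a *: v = 0) -> a = 0.
Proof.
elim/qring_ind: a => a h; apply/qring_pi_mem/annP => x.
by rewrite -qact_piZ; exact: h.
Qed.

End AnnihilatorQuotientModule.

Section QuotientRingIdeals.
Variables (R : comPzRingType) (I : ideal R).
Local Notation pi := (qring_pi I).

Lemma noeth_qring : noeth (setT : set R^o) -> noeth (setT : set (qring I)^o).
Proof.
move=> nR F [W0 FW0] hF.
have [||_ [[W FW <-] mx]] := nR [set pi @^-1` W | W in F].
- by exists (pi @^-1` W0), W0.
- by move=> _ [W FW <-]; split=> //; apply: submod_pi_preim; case: (hF _ FW).
exists W; split=> // W' FW' WW'.
rewrite -(pi_im_preim W') -(pi_im_preim W); apply: image_subset.
by apply: mx; [exists W'|move=> a; exact: WW'].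
Qed.

Lemma mem_image_ideal (J : ideal R) :
  [set x : (qring I)^o | x \in image_ideal I J] = pi @` [set a : R^o | a \in J].
Proof. exact: (mem_spanmP (submod_pi_im I (submod_mem J))). Qed.

Lemma lspan_pi (xs : seq R^o) :
  pi @` lspan xs = lspan (map pi xs : seq (qring I)^o).
Proof.
elim: xs => [|x xs IH] /=; first by rewrite image_set1 qring_pi0.
rewrite -IH; apply/seteqP; split.
  move=> _ [_ [u [_ [Uu [a ->] ->]]] <-]; exists (pi u), (pi (a * x)).
  split; [by exists u|by exists (pi a); rewrite [LHS]qring_piM|exact: qring_piD].
move=> _ [_ [_ [[u Uu <-] [a ->] ->]]]; elim/qring_ind: a => a.
exists (u + a * x); first by exists u, (a * x); split=> //; exists a.
by rewrite qring_piD qring_piM.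
Qed.

End QuotientRingIdeals.

Section LocalRings.
Variables (R : comPzRingType) (m : ideal R).
Hypotheses (nR : noeth (setT : set R^o)) (lm : is_local m).

(** If a were not a unit, the maximal condition would give a maximal ideal containing a, and this
    ideal is m. *)
Lemma is_local_unit (a : R) : a \notin m -> exists b, b * a = 1.
Proof.
move=> am; apply: contrapT => nu.
have [||U [[sU [U1 Ua]] mx]] :=
    nR (F := [set U : set R^o | submod U /\ (~ U 1 /\ U a)]).
- exists (line (a : R^o)); split; first exact: submod_line.
  by split; [move=> [b e]; apply: nu; exists b|exact: line_id].
- by move=> U [].
have UE x : (x \in spanm U) = U x :> Prop.
  by rewrite -[RHS](congr1 (fun W => W x) (mem_spanmP sU)).
have mU : is_maximal (spanm U : ideal R).
  split; first by apply/negP; rewrite UE.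
  move=> J UJ pJ x xJ; rewrite UE; apply: (mx [set y | y \in J]) xJ.
    split; first exact: submod_mem.
    by split; [apply/negP|apply: UJ; rewrite UE].
  by move=> y Uy /=; apply: UJ; rewrite UE.
by move/negP: am; rewrite -(lm.2 _ mU) UE; apply.
Qed.

Lemma is_local_at : local_at [set a : R^o | a \in m].
Proof.
have u a := @is_local_unit a; split; last by move=> a /negP /u.
have [[m1 _] _] := lm; split; [exact: submod_mem|exact/negP|].
move=> a b /= ab; have [|am] := boolP (a \in m); [by left|right].
have [c ca] := u a am; rewrite -[b]mul1r -ca -mulrA; exact: idealMl.
Qed.

End LocalRings.

(** * The inequality for a faithful module *)

Section Bound.
Variables (K : realType) (A : comPzRingType) (m I : ideal A).

Lemma hilb_zero (V : lmodType A) (xs : seq A) n :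
  hilb xs [set 0 : V] n = ell (gpow xs (setT : set V) n) setT.
Proof.
rewrite /hilb sadd_absorb //; [exact: submod_zero|exact: submod_gpow|].
by move=> _ ->; exact: submod0 (submod_gpow xs n (submodT V)).
Qed.

Lemma limn_scaled (u : nat -> nat) t (e : K) :
  (fun n => (u n)%:R / n%:R ^+ t) @ \oo --> e ->
  limn (fun n => ((t`!%:R / n%:R ^+ t)%R%:E * ((u n)%:R)%:E)%E) = (t`!%:R * e)%:E.
Proof.
move=> h; have h1 : (fun n => t`!%:R * ((u n)%:R / n%:R ^+ t)) @ \oo --> t`!%:R * e.
  exact: cvgMl_tmp h.
have -> : (fun n => ((t`!%:R / n%:R ^+ t)%R%:E * ((u n)%:R)%:E)%E) =
    EFin \o (fun n => t`!%:R * ((u n)%:R / n%:R ^+ t) : K).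
  by apply/funext => n /=; rewrite -EFinM mulrAC mulrA.
by rewrite EFin_lim; [congr EFin; exact: cvg_lim|apply/cvg_ex; eexists; exact: h1].
Qed.

Variable xs : seq A.
Hypothesis Ixs : [set a : A^o | a \in I] = lspan (xs : seq A^o).

Lemma len_powm (V : lmodType A) n : finlen (gpow xs (setT : set V) n) setT ->
  len K (qmod (powm I V n)) = ((ell (gpow xs (setT : set V) n) setT)%:R)%:E.
Proof. by rewrite -(mem_powm Ixs) => /(len_qmod K). Qed.

Lemma len_smul (V : lmodType A) : finlen (gpow xs (setT : set V) 1) setT ->
  len K (qmod (smul I (whole V))) = ((ell (gpow xs (setT : set V) 1) setT)%:R)%:E.
Proof.
have e : [set v | v \in smul I (whole V)] = gpow xs (setT : set V) 1.
  by rewrite (mem_smul Ixs) mem_whole.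
by rewrite -e => /(len_qmod K).
Qed.

Lemma multiplicityE (V : lmodType A) (e : K) :
  (forall n, finlen (gpow xs (setT : set V) n) setT) ->
  (fun n => (ell (gpow xs (setT : set V) n) setT)%:R / n%:R ^+ dimn V) @ \oo --> e ->
  multiplicity K I V = ((dimn V)`!%:R * e)%:E.
Proof.
move=> f /limn_scaled <-; congr (limn _); apply/funext => n.
by rewrite len_powm.
Qed.

Lemma ann_regular : [set a : A^o | a \in ann A^o] = [set 0].
Proof.
apply/seteqP; split=> a /=; last by move=> ->; apply: rpred0.
by move/annP => /(_ 1) <-; rewrite -[LHS]mulr1.
Qed.

Hypotheses (nA : noeth (setT : set A^o)) (lm : local_at [set a : A^o | a \in m]).
Hypothesis Im : m_cofinite m A^o I.

Lemma cofinite_sub : {subset I <= m}.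
Proof.
move=> a aI; have := Im => /(congr1 (fun S => S a)) /= <-.
by exists 1%N; rewrite expr1; apply: mem_spanm; left.
Qed.

Lemma cofinite_rad (P : set A^o) : primeI P -> (forall x, x \in xs -> P x) ->
  [set a : A^o | a \in m] `<=` P.
Proof.
move=> pP xP a /=; have := Im => /(congr1 (fun S => S a)) /= <- [n an].
apply: (primeI_exp pP (n := n)); move: an; apply: spanm_sub; first exact: primeI_sub.
move=> b [bI|].
  have : lspan (xs : seq A^o) b by rewrite -Ixs.
  by apply: lspan_sub; [exact: primeI_sub|exact: xP].
move=> bann; have : [set b : A^o | b \in ann A^o] b by [].
by rewrite ann_regular => ->; exact: submod0 (primeI_sub pP).
Qed.

Lemma mem_gens x : x \in xs -> x \in m.
Proof.
move=> xxs; apply: cofinite_sub.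
by have : lspan (xs : seq A^o) x by [apply: lspan_mem]; rewrite -Ixs.
Qed.

Lemma finlen_gens (V : lmodType A) n : noeth (setT : set V) ->
  finlen (gpow xs (setT : set V) n) setT.
Proof.
move=> nV; have := finlen_xs nA lm cofinite_rad n nV (@submod_zero A V).
rewrite sadd_absorb //; [exact: submod_zero|exact: submod_gpow|].
by move=> _ ->; exact: submod0 (submod_gpow xs n (submodT V)).
Qed.

Lemma ex_dim : exists t, [/\ kdim A = t%:E, pch [set 0 : A^o] t &
  forall k, pch [set 0 : A^o] k -> (k <= t)%N].
Proof.
have [||h1 h2] := @natmaxP [set k | pch [set 0 : A^o] k] (size xs).
- exists 0%N; apply: pch_sub (pch0 lm.1) => _ ->; exact: submod0 (primeI_sub lm.1).
- by move=> k; apply: (pch_bound K nA lm mem_gens cofinite_rad).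
by eexists; split; [rewrite kdim_pch; exact: nat_supE h1 h2|exact: h1|exact: h2].
Qed.

Lemma mdim_regular : mdim A^o = kdim A.
Proof. by rewrite /mdim kdim_qring ann_regular kdim_pch. Qed.

(** A prime with a chain of length t above it is minimal, hence associated, hence in [Assh]; so the
    length of its localization is one of those over which the supremum is taken. *)
Lemma count_le_max_loc_length t (vs : seq A^o) (Q : set A^o) : kdim A = t%:E ->
  (forall k, pch [set 0 : A^o] k -> (k <= t)%N) ->
  filt [set 0] vs -> Q \in fprimes [set 0] vs -> pch Q t ->
  (((count_mem Q (fprimes [set 0] vs))%:R)%:E <= max_loc_length K A)%E.
Proof.
move=> kA tP fvs Qvs Qt; have pQ := fprimes_prime fvs Qvs.
have Q0 : [set 0] `<=` Q by move=> _ ->; exact: submod0 (primeI_sub pQ).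
have [P PE] := primeI_spec pQ; subst Q.
apply: le_trans (count_le_len K P fvs) _.
apply: ereal_sup_ubound; exists P => //; split; last first.
  rewrite mdim_regular kA kdim_qring; apply: nat_supE => // k.
  by move=> /(pch_sub Q0); exact: tP.
have [P' pP' P'P|x hx] := minimal_prime_assoc nA pQ.
  apply: (pch_max_sub pP' _ P'P tP Qt).
  by move=> _ ->; exact: submod0 (primeI_sub pP').
by exists x => a; exact: hx.
Qed.

(** The left side spells out lengths and limit instead of using [multiplicity], so that for V =
    [qact M] it can be rewritten into the corresponding expression for M over R. *)
Lemma ratio_le (V : lmodType A) (vs : seq V) t : lspan vs = setT -> (0 < size vs)%N ->
  (forall a : A, (forall v : V, a *: v = 0) -> a = 0) -> kdim A = t%:E ->
  (((ell (gpow xs (setT : set V) 1) setT)%:R)%:E /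
   limn (fun n => (t`!%:R / n%:R ^+ t)%R%:E *
     ((ell (gpow xs (setT : set V) n) setT)%:R)%:E) <=
   max_loc_length K A * n_inv K m A^o * ((size vs)%:R)%:E)%E.
Proof.
move=> gV vs0 fV kA.
have nV : noeth (setT : set V) by rewrite -gV; exact: noeth_lspan.
have [t' [kA' tt tP]] := ex_dim; have et : t' = t by move: kA'; rewrite kA => -[].
subst t'; have [us fus] := ex_filt nA lm nA (@submod_zero A A^o).
pose C : K := (size (fprimes [set 0] us))%:R.
have mloc Q := @count_le_max_loc_length t us Q kA tP fus.
(* Some factor prime has dimension t and occurs at least once. This keeps the supremum from being
   -oo or 0. *)
have c1 : (1%:E <= max_loc_length K A)%E.
  have [P [pP _ sP]] := tt.
  have [|Q Qus QP] := @filt_cover _ _ [set 0] us (P 0%N) (@submod_zero A A^o) fus (pP 0%N).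
    by move=> a /(_ 1) h; suff -> : a = 0 by [exact: submod0 (primeI_sub (pP 0%N))]; rewrite -[a]mulr1.
  have Qt : pch Q t by exists P; split.
  by apply: le_trans (mloc Q Qus Qt); rewrite lee_fin ler1n -has_count has_pred1.
have core (c : K) : 0 <= c -> (forall Q, Q \in fprimes [set 0] us -> pch Q t ->
    (count_mem Q (fprimes [set 0] us))%:R <= c) -> exists eA eV : K,
    [/\ 0 <= eA, 0 <= eV, eA <= c * eV,
    multiplicity K I A^o = (t`!%:R * eA)%:E &
    limn (fun n => (t`!%:R / n%:R ^+ t)%R%:E *
     ((ell (gpow xs (setT : set V) n) setT)%:R)%:E)%E = (t`!%:R * eV)%:E].
  move=> c0 hc.
  have [eA [eV [eA0 eV0 le_e]]] := multiplicity_le nA lm cofinite_rad tP nV fV fus c0 hc.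
  have dA : dimn A^o = t by rewrite /dimn mdim_regular kA.
  move=> hA hV; exists eA, eV; split=> //; last first.
    by apply: limn_scaled; under eq_fun do rewrite -hilb_zero.
  have := @multiplicityE A^o eA; rewrite dA; apply.
    by move=> n; exact: finlen_gens.
  by under eq_fun do rewrite -hilb_zero.
set b := ell (gpow xs (setT : set A^o) 1) setT.
have b0 : (0 < b)%N.
  rewrite /b -hilb_zero; apply: leq_trans (_ : hilb xs [set a : A^o | a \in m] 1 <= _)%N.
    exact: (hilb_prime_gt0 nA lm mem_gens cofinite_rad lm.1).
  apply: ell_mono => //; try exact: submod_hilb; try exact/submod_hilb/submod_zero.
  - exact/submod_hilb/submod_mem.
  - by apply: sadd_mono => // _ ->; exact: rpred0.
  - exact: (finlen_xs nA lm cofinite_rad _ nA (@submod_zero A A^o)).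
have ab : (ell (gpow xs (setT : set V) 1) setT <= size vs * b)%N.
  by apply: ell_gsum_le => //; [exact: (finlen_gens 1 nV)|exact: (finlen_gens 1 nA)].
have nAge : ((b%:R)%:E / multiplicity K I A^o <= n_inv K m A^o)%E.
  apply: ereal_sup_ubound; exists I => //.
  by rewrite len_smul //; exact: finlen_gens.
set a := ell _ _ in ab *.
have a0 : 0 <= (a%:R : K) by [].
have vs0' : 0 < ((size vs)%:R : K) by rewrite ltr0n.
have t0 : 0 < (t`!%:R : K) by rewrite ltr0n fact_gt0.
have b0' : 0 < (b%:R : K) by rewrite ltr0n.
(* For c = +oo the right side is +oo once [n_inv] is positive, and b / e(I, A) is positive even if
   e(I, A) = 0, being +oo then. The number of factors replaces c as the finite bound that [core]
   requires. *)
case ec : (max_loc_length K A) c1 mloc => [c| |] // c1 mloc; last first.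
  have [|eA [eV [eA0 _ _ mA _]]] := core C (ler0n _ _).
    by move=> Q _ _; rewrite ler_nat count_size.
  have n0 : (0 < n_inv K m A^o)%E.
    apply: lt_le_trans nAge; rewrite mA inver; case: ifPn => [_|ne0].
      by rewrite gt0_muley ?lte_fin.
    rewrite -EFinM lte_fin divr_gt0 // lt0r ne0 mulr_ge0 //; exact: ltW.
  by rewrite gt0_mulye // gt0_mulye ?lte_fin // leey.
rewrite lee_fin in c1; have c0 : 0 < c by exact: lt_le_trans c1.
have [|eA [eV [eA0 eV0 le_e mA ->]]] := core c (ltW c0).
  by move=> Q Qus Qt; have := mloc Q Qus Qt; rewrite lee_fin.
(* If e(I, A) = 0, the ratio b / 0 is +oo, and so is the right side. Otherwise eA <= c eV makes e(I,
   V) positive too, and the inequality is one between real numbers. *)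
have [eA1|eA1] := eqVneq eA 0.
  have -> : n_inv K m A^o = +oo%E.
    apply/eqP; rewrite -leye_eq; apply: le_trans nAge.
    by rewrite mA eA1 mulr0 inver eqxx gt0_muley ?lte_fin.
  by rewrite gt0_muley ?lte_fin // gt0_mulye ?lte_fin // leey.
have eA2 : 0 < eA by rewrite lt0r eA1.
have eV2 : 0 < eV.
  by rewrite -(pmulr_rgt0 _ c0); exact: lt_le_trans le_e.
have lb : ((a%:R)%:E / (t`!%:R * eV)%:E <=
    c%:E * ((b%:R)%:E / multiplicity K I A^o) * ((size vs)%:R)%:E)%E.
  rewrite mA !inver !mulf_eq0 !gt_eqF //= -!EFinM lee_fin.
  rewrite ler_pdivrMr ?mulr_gt0 //.
  have -> : c * (b%:R / (t`!%:R * eA)) * (size vs)%:R * (t`!%:R * eV) =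
      ((size vs)%:R * b%:R) * ((c * eV) / eA).
    by field; rewrite ?gt_eqF.
  apply: le_trans (_ : (size vs)%:R * b%:R * 1 <= _).
    by rewrite mulr1 -natrM ler_nat.
  by rewrite ler_wpM2l ?mulr_ge0 // ler_pdivlMr // mul1r.
apply: le_trans lb _; rewrite lee_wpmul2r ?lee_fin //.
by rewrite lee_wpmul2l // lee_fin ltW.
Qed.

End Bound.

Lemma infimum_mem (S : set nat) : S !=set0 -> S (infimum 0%N S).
Proof.
move=> [k Sk]; have ex : exists k, `[< S k >] by exists k; apply/asboolP.
case: (ex_minnP ex) => b /asboolP Sb hb.
have h : infimums S b by split; [move=> l Sl; apply: hb; exact/asboolP|move=> c; apply].
rewrite /infimum; case: ifPn => [/eqP e|_]; first by rewrite e in Sk.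
by rewrite (is_subset1_infimums (xgetPex 0%N (ex_intro _ b h)) h).
Qed.

Lemma submod_pi_ideal (A : comPzRingType) (I : ideal A) (S : set (qring I)^o) (a : A) :
  submod S -> a \in I -> S (qring_pi I a).
Proof.
move=> sS aI; have -> : qring_pi I a = 0 by apply/qring_pi_mem.
exact: submod0 sS.
Qed.

Lemma ex_min_generators (A : comPzRingType) (V : lmodType A) : fin_gen V ->
  exists2 vs : seq V, lspan vs = setT & size vs = mu V.
Proof.
move=> [vs gvs]; have [|ws gws e] := @infimum_mem [set size s | s in @generates A V].
  by exists (size vs), vs.
by exists ws; [exact: generatesP|].
Qed.

Section QuotientByAnnihilator.
Variables (R : comPzRingType) (m : ideal R) (M : lmodType R).
Hypotheses (nR : noeth (setT : set R^o)) (lm : local_at [set a : R^o | a \in m]).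
Hypothesis M0 : exists x : M, x != 0.

Local Notation pi := (qring_pi (ann M)).

Lemma ann_sub_max : [set a : R^o | a \in ann M] `<=` [set a | a \in m].
Proof.
apply: (proper_sub_max lm); first exact: submod_mem.
by move: M0 => [x x0] /annP /(_ x) e; rewrite -[x]scale1r e eqxx in x0.
Qed.

Lemma local_at_qring :
  local_at [set x : (qring (ann M))^o | x \in image_ideal (ann M) m].
Proof.
rewrite mem_image_ideal; split; first exact: (primeI_pi_im ann_sub_max lm.1).
elim/qring_ind=> a nma; have [|b ba] := lm.2 a; first by move=> ma; apply: nma; exists a.
by exists (pi b); rewrite -qring_piM ba.
Qed.

(** I + ann M is the preimage of the extension of I, and the annihilator of Rbar over itself is
    zero, so both conditions concern the same radical. *)
Lemma cofinite_image (I : ideal R) : m_cofinite m M I ->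
  m_cofinite (image_ideal (ann M) m) (qring (ann M))^o (image_ideal (ann M) I).
Proof.
move=> Im.
have mE x : (x \in image_ideal (ann M) m) = (pi @` [set a : R^o | a \in m]) x :> Prop.
  by rewrite -mem_image_ideal.
have IE x : (x \in image_ideal (ann M) I) = (pi @` [set a : R^o | a \in I]) x :> Prop.
  by rewrite -mem_image_ideal.
have radE a : (a \in m) = radical (addm I (ann M)) a :> Prop.
  by have := Im => /(congr1 (fun S => S a)) /= <-.
have [pm _] := local_at_qring; rewrite mem_image_ideal in pm.
apply/seteqP; split=> x /=; rewrite mE.
  move=> [n xn]; apply: (primeI_exp pm (n := n)); move: xn.
  apply: spanm_sub; first exact: primeI_sub.
  move=> y [|]; last first.
    move=> yann; have : [set a : (qring (ann M))^o | a \in ann (qring (ann M))^o] y by [].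
    by rewrite ann_regular => ->; exact: submod0 (primeI_sub pm).
  rewrite IE => -[a aI <-]; exists a => //=; rewrite radE.
  by exists 1%N; rewrite expr1; apply: mem_spanm; left.
move=> [a /= am <-]; move: am; rewrite radE => -[n an]; exists n.
have -> : pi a ^+ n = pi (a ^+ n).
  by elim: n {an} => // n IH; rewrite !exprS IH qring_piM.
have sI := submod_mem (addm (image_ideal (ann M) I) (ann (qring (ann M))^o)).
move: an; apply: (spanm_sub (submod_pi_preim sI)) => b [bI|bann].
  by apply: mem_spanm; left; rewrite /= IE; exists b.
exact: (submod_pi_ideal sI bann).
Qed.

End QuotientByAnnihilator.

Local Open Scope ereal_scope.

Theorem mainTheorem3 (K : realType) (R : comPzRingType) (m : ideal R)
    (M : lmodType R) :
  noetherian R -> is_local m ->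
  fin_gen M -> (exists x : M, x != 0%R) -> quasi_unmixed m M ->
  let Rbar := qring (ann M) in
  let mbar := image_ideal (ann M) m in
  let c := max_loc_length K Rbar in
  n_inv K m M / (mu M)%:R%:E <= c * n_inv K mbar Rbar^o.
Proof.
move=> noethR lR fgM M0 _; lazy zeta.
set Rbar := qring (ann M); set mbar := image_ideal (ann M) m.
have nR := noetherian_noeth noethR; have lm := is_local_at nR lR.
have nRbar : noeth (setT : set Rbar^o) by exact: noeth_qring.
have lmbar := local_at_qring lm M0.
have [vs gvs <-] := ex_min_generators fgM.
(* M is nonzero, so mu(M) > 0 and dividing by it can be turned into multiplying the other side. *)
have vs0 : (0 < size vs)%N.
  case: vs gvs => //= e; have [x] := M0.
  by have : [set: M] x by []; rewrite -e => /= ->; rewrite eqxx.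
rewrite inver pnatr_eq0 gtn_eqF //=.
rewrite lee_pdivrMr ?ltr0n //; apply: ub_ereal_sup => _ [I Im ->].
have [s Is] := noethR I; pose xs : seq R := s.
have Ixs : [set a : R^o | a \in I] = lspan (xs : seq R^o).
  by rewrite -spanm_lspan; apply/seteqP; split=> a /=; rewrite Is.
pose xsb : seq Rbar := map (qring_pi (ann M)) xs.
have Ixsb : [set x : Rbar^o | x \in image_ideal (ann M) I] = lspan (xsb : seq Rbar^o).
  by rewrite mem_image_ideal Ixs lspan_pi.
have Imb := cofinite_image lm M0 Im.
have [t [kt _ _]] := ex_dim K Ixsb nRbar lmbar Imb.
have gq : lspan (vs : seq (qact M)) = setT by rewrite lspan_qact.
have nq : noeth (setT : set (qact M)) by rewrite -gq; exact: noeth_lspan.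
have fl n : finlen (gpow xs (setT : set M) n) setT.
  apply: finlen_qact; rewrite -gpow_qact.
  exact: (finlen_gens Ixsb nRbar lmbar Imb n nq).
have := ratio_le K Ixsb nRbar lmbar Imb gq vs0 (@qact_faithful _ M) kt.
rewrite gpow_qact ell_qact.
rewrite (len_smul K Ixs (fl _)); congr (_ / _ <= _).
(* By definition dim M is the dimension of R / ann M, so the same t normalizes both limits. *)
rewrite /multiplicity /dimn /mdim kt; congr (limn _); apply/funext => n.
by rewrite gpow_qact ell_qact (len_powm K Ixs (fl _)).
Qed.
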